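(* Let $X$ be a connected linear algebraic group over $\overline{\mathbb{F}}_p$ and let $\sigma$ be a Steinberg endomorphism of $X$. Let $l,m\geq 1$ with $l \mid m$, and let $F$ be the Shintani map of $(X,\sigma^m,\sigma^l)$, so that $F$ maps $X_{\sigma^m}$-classes in $X_{\sigma^m}\widetilde{\sigma}^l$ to $X_{\sigma^l}$-classes in $X_{\sigma^l}$. Let $x\in X_{\sigma^m}$ and let $k$ be a prime divisor of $m$. (i) If $k$ divides $m/l$, then $x\widetilde{\sigma}^l$ is contained in an $X_{\sigma^m}$-conjugate of $\langle X_{\sigma^{m/k}},\widetilde{\sigma}\rangle$ if and only if $F(x\widetilde{\sigma}^l)=z^k$ for some $z\in X_{\sigma^l}$. (ii) Assume $F(x\widetilde{\sigma}^l)^X\cap X_{\sigma^l}=F(x\widetilde{\sigma}^l)^{X_{\sigma^l}}$. If $k$ does not divide $m/l$, then $x\widetilde{\sigma}^l$ is contained in an $X_{\sigma^m}$-conjugate of $\langle X_{\sigma^{m/k}},\widetilde{\sigma}\rangle$ if and only if $F(x\widetilde{\sigma}^l)$ is contained in an $X_{\sigma^l}$-conjugate of $X_{\sigma^{l/k}}$.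
   Context: For a Steinberg endomorphism $\sigma$ of $X$, write $X_\sigma=\{x\in X\mid x^\sigma=x\}$ (a finite group); maps are written as exponents, acting on the right, and in semidirect products $\sigma^{-1}x\sigma=x^\sigma$. $g^X$ denotes the set of $X$-conjugates of $g$. Here $\widetilde{\sigma}$ is the restriction $\sigma|_{X_{\sigma^m}}$, and products such as $x\widetilde{\sigma}^l$ and subgroups such as $\langle X_{\sigma^{m/k}},\widetilde{\sigma}\rangle$ are taken in the semidirect product $X_{\sigma^m}{:}\langle\widetilde{\sigma}\rangle$. Shintani map: let $\sigma_1,\sigma_2$ be commuting Steinberg endomorphisms of a connected algebraic group $X$. For $\{i,j\}=\{1,2\}$ write $\widetilde{\sigma}_i=\sigma_i|_{X_{\sigma_j}}$, and form $X_{\sigma_j}{:}\langle\widetilde{\sigma}_i\rangle$ (with $\langle\widetilde{\sigma}_i\rangle\cap X_{\sigma_j}=1$). The Shintani map $F$ of $(X,\sigma_1,\sigma_2)$ is the well-defined bijection $$F\colon\{g^{X_{\sigma_1}}\mid g\in X_{\sigma_1}\widetilde{\sigma}_2\}\to\{h^{X_{\sigma_2}}\mid h\in X_{\sigma_2}\widetilde{\sigma}_1\},$$ where for $x\in X_{\sigma_1}$, $y\in X_{\sigma_2}$: $F((x\widetilde{\sigma}_2)^{X_{\sigma_1}})=(y\widetilde{\sigma}_1)^{X_{\sigma_2}}$ if and only if the pairs $(x\sigma_2,\sigma_1)$ and $(\sigma_2,y\sigma_1)$ are simultaneously $X$-conjugate, i.e. $(x\sigma_2,\sigma_1)^X=(\sigma_2,y\sigma_1)^X$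 (in $X{:}\langle\sigma_1,\sigma_2\rangle$). One writes $F(g)$ on elements, meaning any representative of the class $F(g^{X_{\sigma_1}})$ (so $F(g)=z^k$ for some $z$ in a given set means that some such $z$ has $z^k$ in the class $F(g^{X_{\sigma_1}})$). For $(\sigma_1,\sigma_2)=(\sigma^m,\sigma^l)$ with $l\mid m$, $\widetilde{\sigma}_1=1$, so $F$ takes values in classes of $X_{\sigma^l}$. *)

(* Defs.v *)
From HB Require Import structures.
From mathcomp Require Import all_boot all_algebra.
From mathcomp Require Import boolp classical_sets.
From mathcomp Require Import mpoly.

Set Implicit Arguments.
Unset Strict Implicit.
Unset Printing Implicit Defensive.

Import GRing.Theory.

Local Open Scope group_scope.
Local Open Scope classical_set_scope.

Record subgroup (G : groupType) := Subgroup {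
  subgroup_set :> set G;
  subgroup_closed : group_closed [pred x | x \in subgroup_set] }.

Definition elt (G : groupType) (H : subgroup G) : Type :=
  {x : G | [pred x | x \in subgroup_set H] x}.

HB.instance Definition _ G H := SubChoice.on (@elt G H).
HB.instance Definition _ G H :=
  SubChoice_isSubGroup.Build G _ (@elt G H) (subgroup_closed H).

Lemma eltP (G : groupType) (H : subgroup G) (x : elt H) : subgroup_set H (val x).
Proof. exact: set_mem (valP x). Qed.

Definition to_elt (G : groupType) (H : subgroup G) (x : G) (Hx : subgroup_set H x) : elt H :=
  Sub x (mem_set Hx).

Definition conj_set (G : groupType) (A : set G) (h : G) : set G :=
  [set a ^ h | a in A].

(* [conj_class H g] is g^H, and [conj_closure H A] is A^H. *)
Definition conj_class (G : groupType) (H : set G) (g : G) : set G :=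
  [set g ^ h | h in H].

Definition conj_closure (G : groupType) (H A : set G) : set G :=
  \bigcup_(a in A) conj_class H a.

Definition generated (G : groupType) (A : set G) : set G :=
  \bigcap_(H in [set H : subgroup G | A `<=` H]) (H : set G).

Record aut (G : groupType) := Aut {
  aut_fun :> G -> G;
  aut_inv : G -> G;
  autM : {morph aut_fun : x y / x * y};
  autK : cancel aut_fun aut_inv;
  autKV : cancel aut_inv aut_fun }.

HB.instance Definition _ G := gen_eqMixin (aut G).
HB.instance Definition _ G := gen_choiceMixin (aut G).

Section AutGroup.
Variable G : groupType.
Implicit Types a b c : aut G.

Lemma autP a b : a =1 b -> a = b.
Proof.
case: a b => f g fM fK gK [f' g' fM' fK' gK'] /= eff'.
have ef : f = f' by apply/funext.
have eg : g = g'.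
  by apply/funext => x; rewrite -[x in LHS]gK' -ef fK.
move: fM fK gK fM' fK' gK'; rewrite -ef -eg => *.
by congr Aut; apply: Prop_irrelevance.
Qed.

Fact autVM a : {morph aut_inv a : x y / x * y}.
Proof. by move=> x y; apply: (can_inj (autK a)); rewrite autM !autKV. Qed.

Fact aut_mulM a b : {morph b \o a : x y / x * y}.
Proof. by move=> x y /=; rewrite !autM. Qed.

Definition aut_one : aut G :=
  @Aut G id id (fun _ _ => erefl) (fun _ => erefl) (fun _ => erefl).

(* Maps act on the right: [a * b] is [a] followed by [b]. *)
Definition aut_mul a b : aut G :=
  Aut (aut_mulM a b) (can_comp (autK b) (autK a)) (can_comp (autKV a) (autKV b)).

Definition aut_opp a : aut G := Aut (autVM a) (autKV a) (autK a).

Fact aut_mulA : associative aut_mul. Proof. by move=> a b c; apply: autP. Qed.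
Fact aut_mul1 : left_id aut_one aut_mul. Proof. by move=> a; apply: autP. Qed.
Fact aut_mulr1 : right_id aut_one aut_mul. Proof. by move=> a; apply: autP. Qed.
Fact aut_mulV : left_inverse aut_one aut_opp aut_mul.
Proof. by move=> a; apply: autP => x /=; rewrite autKV. Qed.
Fact aut_mulrV : right_inverse aut_one aut_opp aut_mul.
Proof. by move=> a; apply: autP => x /=; rewrite autK. Qed.

HB.instance Definition _ :=
  isGroup.Build (aut G) aut_mulA aut_mul1 aut_mulr1 aut_mulV aut_mulrV.

Lemma autME a b x : (a * b) x = b (a x). Proof. by []. Qed.
Lemma aut1E x : (1 : aut G) x = x. Proof. by []. Qed.
Lemma autVE a : (a^-1 : G -> G) = aut_inv a. Proof. by []. Qed.
Lemma aut1 a : a 1 = 1.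
Proof. by apply: (mulgI (a 1)); rewrite -autM !mulg1. Qed.
Lemma autV a x : a x^-1 = (a x)^-1.
Proof. by apply: (mulgI (a x)); rewrite -autM !mulgV aut1. Qed.
Lemma autXE a n x : (a ^+ n) x = iter n a x.
Proof. by elim: n x => // n IHn x; rewrite expgSr autME IHn. Qed.

End AutGroup.

(* [hol G] is the semidirect product G:Aut(G); the pair (x, a) stands for the
   product x a, and a^-1 x a = a x (lemma [hol_conj]).  For a in Aut(G), the
   group G:<a> is the subgroup of [hol G] generated by [inG G] and [inA a]. *)
Record hol (G : groupType) := Hol { hol_l : G; hol_r : aut G }.

HB.instance Definition _ G := gen_eqMixin (hol G).
HB.instance Definition _ G := gen_choiceMixin (hol G).

Section HolGroup.
Variable G : groupType.
Implicit Types u v w : hol G.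

Definition hol_mul u v :=
  Hol (hol_l u * (hol_r u)^-1 (hol_l v)) (hol_r u * hol_r v).
Definition hol_one : hol G := Hol 1 1.
Definition hol_opp u := Hol (hol_r u (hol_l u)^-1) (hol_r u)^-1.

Fact hol_mulA : associative hol_mul.
Proof.
move=> [x a] [y b] [z c]; congr Hol; last exact: mulgA.
change (x * a^-1 (y * b^-1 z) = x * a^-1 y * (a * b)^-1 z).
by rewrite invgM autM autME mulgA.
Qed.
Fact hol_mul1 : left_id hol_one hol_mul.
Proof.
move=> [x a]; congr Hol; last exact: mul1g.
by change (1 * (1 : aut G)^-1 x = x); rewrite invg1 aut1E mul1g.
Qed.
Fact hol_mulr1 : right_id hol_one hol_mul.
Proof.
move=> [x a]; congr Hol; last exact: mulg1.
by change (x * a^-1 1 = x); rewrite aut1 mulg1.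
Qed.
Fact hol_mulV : left_inverse hol_one hol_opp hol_mul.
Proof.
move=> [x a]; congr Hol; last exact: mulVg.
change (a x^-1 * (a^-1)^-1 x = 1).
by rewrite invgK -autM mulVg aut1.
Qed.
Fact hol_mulrV : right_inverse hol_one hol_opp hol_mul.
Proof.
move=> [x a]; congr Hol; last exact: mulgV.
by change (x * a^-1 (a x^-1) = 1); rewrite autVE autK mulgV.
Qed.

HB.instance Definition _ :=
  isGroup.Build (hol G) hol_mulA hol_mul1 hol_mulr1 hol_mulV hol_mulrV.

Definition inG (x : G) : hol G := Hol x 1.
Definition inA (a : aut G) : hol G := Hol 1 a.

Lemma hol_conj (x : G) (a : aut G) : inG x ^ inA a = inG (a x).
Proof.
rewrite conjgE; congr Hol; last by change (a^-1 * (1 * a) = 1); rewrite mul1g mulVg.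
change (a 1^-1 * (a^-1)^-1 (x * (1 : aut G)^-1 1) = a x).
by rewrite !invg1 !aut1 mul1g invgK mulg1.
Qed.

End HolGroup.

Section Fixed.
Variable G : groupType.

Fact fix_closed (s : aut G) :
  group_closed [pred x | x \in [set x : G | s x = x]].
Proof.
split=> [|x y]; first by apply: mem_set; apply: aut1.
move=> /set_mem sx /set_mem sy; apply: mem_set.
by rewrite /= autM autV sx sy.
Qed.

(* [fixg s] is G_s. *)
Definition fixg (s : aut G) : subgroup G := Subgroup (fix_closed s).

Variables (s t : aut G) (st : commute s t).

Fact restr_subproof (x : elt (fixg s)) : subgroup_set (fixg s) (t (val x)).
Proof. by rewrite /= -autME -st autME (eltP x). Qed.

Fact restrV_subproof (x : elt (fixg s)) : subgroup_set (fixg s) (aut_inv t (val x)).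
Proof.
have sV : commute s t^-1 by exact: commuteV.
change (s (t^-1 (val x)) = t^-1 (val x)).
by rewrite -autME -sV autME (eltP x).
Qed.

Definition restr_fun (x : elt (fixg s)) := to_elt (restr_subproof x).
Definition restrV_fun (x : elt (fixg s)) := to_elt (restrV_subproof x).

Fact restrM : {morph restr_fun : x y / x * y}.
Proof. by move=> x y; apply: val_inj; rewrite valM /= autM. Qed.
Fact restrK : cancel restr_fun restrV_fun.
Proof. by move=> x; apply: val_inj; rewrite /= autK. Qed.
Fact restrKV : cancel restrV_fun restr_fun.
Proof. by move=> x; apply: val_inj; rewrite /= autKV. Qed.

Definition restr : aut (elt (fixg s)) := Aut restrM restrK restrKV.

End Fixed.

Section Shintani.
Variables (G : groupType) (s1 s2 : aut G) (s12 : commute s1 s2).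

(* (x s2, s1)^G = (s2, y s1)^G in G:<s1, s2>. *)
Definition sim_conj (x y : G) : Prop :=
  exists a : G, (inG x * inA s2) ^ inG a = inA s2 /\
                inA s1 ^ inG a = inG y * inA s1.

(* The Shintani map of (G, s1, s2), from G_s1-classes in the coset G_s1 s2~
   to G_s2-classes in the coset G_s2 s1~: it sends (x s2~)^{G_s1} to
   (y s1~)^{G_s2} iff (x s2, s1) and (s2, y s1) are simultaneously
   G-conjugate.  It is given as a map on sets, the value being the union of
   the classes corresponding to C; when G is a connected algebraic group and
   s1, s2 are Steinberg endomorphisms there is exactly one. *)
Definition shintani (C : set (hol (elt (fixg s1)))) :
    set (hol (elt (fixg s2))) :=
  [set h | exists (x : elt (fixg s1)) (y : elt (fixg s2)),
     [/\ C = conj_class (range (@inG _)) (inG x * inA (restr s12)),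
         sim_conj (val x) (val y) &
         conj_class (range (@inG _)) (inG y * inA (restr (commute_sym s12))) h]].

End Shintani.

Section GL.
Variables (K : fieldType) (n : nat).

Definition GL : Type := {A : 'M[K]_n | A \in unitmx}.
HB.instance Definition _ := SubChoice.on GL.

Definition mk_GL (A : 'M[K]_n) (uA : A \in unitmx) : GL :=
  exist (fun A : 'M[K]_n => A \in unitmx) A uA.

Fact GL_mul_subproof (A B : GL) : (val A *m val B)%R \in unitmx.
Proof. by rewrite unitmx_mul (valP A) (valP B). Qed.
Fact GL_inv_subproof (A : GL) : invmx (val A) \in unitmx.
Proof. by rewrite unitmx_inv (valP A). Qed.

Definition GL_mul (A B : GL) : GL := mk_GL (GL_mul_subproof A B).
Definition GL_one : GL := mk_GL (unitmx1 K n).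
Definition GL_inv (A : GL) : GL := mk_GL (GL_inv_subproof A).

Fact GL_mulA : associative GL_mul.
Proof. by move=> A B C; apply: val_inj; rewrite /= mulmxA. Qed.
Fact GL_mul1 : left_id GL_one GL_mul.
Proof. by move=> A; apply: val_inj; rewrite /= mul1mx. Qed.
Fact GL_mulr1 : right_id GL_one GL_mul.
Proof. by move=> A; apply: val_inj; rewrite /= mulmx1. Qed.
Fact GL_mulV : left_inverse GL_one GL_inv GL_mul.
Proof. by move=> A; apply: val_inj; rewrite /= mulVmx ?(valP A). Qed.
Fact GL_mulrV : right_inverse GL_one GL_inv GL_mul.
Proof. by move=> A; apply: val_inj; rewrite /= mulmxV ?(valP A). Qed.

HB.instance Definition _ :=
  isGroup.Build GL GL_mulA GL_mul1 GL_mulr1 GL_mulV GL_mulrV.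

Definition meval_mx (P : {mpoly K[n * n]}) (A : 'M[K]_n) : K :=
  P.@[fun k => mxvec A ord0 k].

(* Polynomials in the entries suffice to cut out the closed subsets of GL_n,
   since a regular function is P / det^r. *)
Definition zariski_closed (Z : set GL) : Prop :=
  exists S : set {mpoly K[n * n]},
    Z = [set A | forall P, S P -> meval_mx P (val A) = 0%R].

End GL.

Record lin_alg_group (K : fieldType) := LinAlgGroup {
  lag_dim : nat;
  lag_pts : subgroup (GL K lag_dim);
  lag_closed : zariski_closed lag_pts }.

Definition lag_elt (K : fieldType) (X : lin_alg_group K) : groupType :=
  elt (lag_pts X).
Coercion lag_elt : lin_alg_group >-> groupType.

Definition lag_mx (K : fieldType) (X : lin_alg_group K) (x : X) :
  'M[K]_(lag_dim X) := val (val x).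

Section LinAlgGroups.
Variable K : fieldType.
Implicit Types X Y : lin_alg_group K.

Definition lag_connected X : Prop :=
  forall Z1 Z2 : set (GL K (lag_dim X)),
    zariski_closed Z1 -> zariski_closed Z2 ->
    lag_pts X `<=` Z1 `|` Z2 -> lag_pts X `&` Z1 `&` Z2 = set0 ->
    lag_pts X `<=` Z1 \/ lag_pts X `<=` Z2.

(* Each entry of f x is a regular function P(x) / (det x)^r. *)
Definition regular X Y (f : X -> Y) : Prop :=
  exists (P : 'I_(lag_dim Y) -> 'I_(lag_dim Y) ->
              {mpoly K[lag_dim X * lag_dim X]}) (r : nat),
    forall (x : X) i j,
      lag_mx (f x) i j = (meval_mx (P i j) (lag_mx x) / \det (lag_mx x) ^+ r)%R.

Definition lag_morphism X Y (f : X -> Y) : Prop :=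
  {morph f : x y / x * y} /\ regular f.

Definition lag_isomorphism X Y (f : X -> Y) : Prop :=
  lag_morphism f /\ exists2 g : Y -> X, lag_morphism g & cancel f g /\ cancel g f.

(* f is the Frobenius endomorphism for some F_q-structure on X: some embedding
   of X as a closed subgroup of GL_N carries f to (a_ij) |-> (a_ij^q). *)
Definition frobenius X (q : nat) (f : X -> X) : Prop :=
  exists (Y : lin_alg_group K) (rho : X -> Y), lag_isomorphism rho /\
    forall x, lag_mx (rho (f x)) = map_mx (fun a => a ^+ q)%R (lag_mx (rho x)).

(* The definition of Malle and Testerman: an endomorphism of algebraic groups
   some power of which is a Frobenius endomorphism.  With it, positive powers
   of a Steinberg endomorphism are again Steinberg endomorphisms. *)
Definition steinberg (p : nat) X (f : X -> X) : Prop :=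
  lag_morphism f /\
  exists e a, [/\ 0 < e, 0 < a & frobenius (p ^ a) (iter e f)].

End LinAlgGroups.

(* [closedFieldType] and [integralRange iota] together say that K is an
   algebraic closure of F_p. *)
Section SteinbergBij.
Variables (p : nat) (K : closedFieldType) (iota : {rmorphism 'F_p -> K}).
Hypotheses (pr_p : prime p) (alg : integralRange iota).

Lemma Fpbar_pchar : p \in [pchar K]%R.
Proof. by rewrite (fmorph_pchar iota) pchar_Fp. Qed.

Lemma Frob_inj i : injective (fun a : K => a ^+ (p ^ i))%R.
Proof.
elim: i => [|i IHi] a b /=; first by rewrite expn0 !GRing.expr1.
rewrite expnSr !GRing.exprM => e; apply: IHi.
by apply: (fmorph_inj (pFrobenius_aut Fpbar_pchar)); rewrite /= !pFrobenius_autE.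
Qed.

Lemma Frob_periodic (a : K) : exists2 d, 0 < d & (a ^+ (p ^ d) = a)%R.
Proof.
have [P monP rootP] := alg a.
pose r i : {poly 'F_p} := ('X^(p ^ i) %% P)%R.
have ra i : ((map_poly iota (r i)).[a] = a ^+ (p ^ i))%R.
  have /(congr1 (fun Q => (map_poly iota Q).[a]%R)) := divp_eq ('X^(p ^ i))%R P.
  rewrite rmorphD rmorphM /= hornerD hornerM (eqP rootP) mulr0 add0r.
  by rewrite map_polyXn hornerXn => <-.
pose T := 'rV['F_p]_(size P).
pose f (i : 'I_#|T|.+1) : T := poly_rV (r i).
have /injectivePn [i [j nij fij]] : ~~ injectiveb f.
  apply/negP => /injectiveP /leq_card.
  by rewrite card_ord ltnn.
wlog ltij : i j nij fij / i < j.
  move=> W; case: (ltngtP i j) => [|ij|eij]; first exact: W.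
    by apply: (W j i) => //; rewrite eq_sym.
  by move: nij; rewrite -val_eqE /= eij eqxx.
have szr k : size (r k) <= size P.
  by apply: ltnW; rewrite ltn_modp monic_neq0.
have rij : r i = r j.
  by rewrite -[r i](poly_rV_K (szr i)) -[r j](poly_rV_K (szr j)) -/(f i) fij.
exists (j - i); first by rewrite subn_gt0.
apply: (@Frob_inj i) => /=; rewrite -GRing.exprM -expnD subnK 1?ltnW //.
by rewrite -!ra rij.
Qed.

Lemma steinberg_bij (X : lin_alg_group K) (f : X -> X) :
  steinberg p f -> exists g : X -> X, cancel f g /\ cancel g f.
Proof.
case=> _ [e [a [e0 a0 [Y [rho [[_ [rho' _ [rhoK _]]] fr]]]]]].
set h := iter e f in fr.
have per (x : X) : exists2 d, 0 < d & iter d f x = x.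
  pose M := lag_mx (rho x).
  have [d d0 dP] : exists2 d, 0 < d & forall i j,
      (M i j ^+ (p ^ d) = M i j)%R.
    have {}per : forall ij : _ * _, exists d, 0 < d /\
        (M ij.1 ij.2 ^+ (p ^ d) = M ij.1 ij.2)%R.
      by move=> ij; have [d ? ?] := Frob_periodic (M ij.1 ij.2); exists d.
    have [d dP] := fin_all_exists per.
    exists (\prod_ij d ij)%N; first by apply: prodn_gt0 => ij; have [] := dP ij.
    move=> i j; rewrite (bigD1 (i, j)) //=.
    have [_] := dP (i, j) => /=; set b := M i j; set k := (\prod_(_ | _) _)%N.
    move=> bE; elim: k => [|k IHk]; first by rewrite muln0 GRing.expr1.
    by rewrite mulnS expnD GRing.exprM bE.
  have hd k : lag_mx (rho (iter k h x)) = map_mx (fun b => b ^+ (p ^ (a * k)))%R M.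
    elim: k => [|k IHk]; first by apply/matrixP => i j; rewrite !mxE muln0 GRing.expr1.
    rewrite iterS fr IHk; apply/matrixP => i j; rewrite !mxE.
    by rewrite -GRing.exprM -expnD mulnS addnC.
  exists (d * e)%N; first by rewrite muln_gt0 d0.
  have -> : iter (d * e)%N f x = iter d h x.
    by elim: (d) => //= k IHk; rewrite mulSn iterD IHk.
  apply: (can_inj rhoK); apply: val_inj; apply: val_inj.
  rewrite -/(lag_mx _) hd; apply/matrixP => i j; rewrite !mxE.
  elim: (a) => [|b IHb]; first by rewrite mul0n GRing.expr1.
  by rewrite mulSn expnD GRing.exprM dP.
have f_inj : injective f.
  move=> x y fxy; have [d d0 dx] := per x; have [d' d'0 dy] := per y.
  have itf k z : 0 < k -> iter k f z = iter k.-1 f (f z).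
    by case: k => // k _; rewrite iterSr.
  have itm k m z : iter k f z = z -> iter (m * k)%N f z = z.
    by move=> kz; elim: m => //= m IHm; rewrite mulSn iterD IHm.
  rewrite -(itm _ d' _ dx) -(itm _ d _ dy) mulnC.
  by rewrite itf ?muln_gt0 ?d0 // fxy -itf ?muln_gt0 ?d0.
have f_surj y : exists x, f x = y.
  have [d d0 dy] := per y; exists (iter d.-1 f y).
  by rewrite -iterS prednK.
have [g gK] := choice f_surj.
by exists g; split => // x; apply: f_inj; rewrite gK.
Qed.

Definition steinberg_aut (X : lin_alg_group K) (f : X -> X)
    (fP : steinberg p f) : aut X :=
  let: exist g (conj fK gK) := cid (steinberg_bij fP) in Aut (proj1 (proj1 fP)) fK gK.

Lemma steinberg_autE (X : lin_alg_group K) (f : X -> X) (fP : steinberg p f) x :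
  steinberg_aut fP x = f x.
Proof. by rewrite /steinberg_aut; case: cid => g []. Qed.

End SteinbergBij.

(* Main.v *)
(* Write S for sigma inside X:<sigma>. The Shintani map sends the class of
   x S^l to that of y exactly when some a in X conjugates x S^l to S^l and S^m
   to y S^m.  Since every c S^j is X-conjugate to S^j (Lang-Steinberg),
   membership in a conjugate of <X_(sigma^n), sigma>, n = m/k, says that some b
   conjugates S^n to an element w S^n commuting with S^l and S^m to y S^m,
   where y S^m = (w S^n)^k.  If l | n then w commutes with S^n, so y = w^k.
   Otherwise Bezout produces from S^l and w S^n an element conjugate to
   S^(l/k), and conversely such pairs are built from powers of y.

   Lang-Steinberg: if sigma^e is the q-Frobenius, then y = a^-1 c sigma(a)
   implies sigma^e(a) = N(c)^-1 a N(y), so the q-th powers of the coordinates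
   of a are linear combinations of these coordinates over functions of y.
   Hence a |-> a^-1 c sigma(a) is a finite morphism whose fibres have bounded
   size and whose image, a sigma-twisted orbit, is closed.  Counting points in
   the finite groups of fixed points of powers of sigma bounds the number of
   orbits; connectedness then leaves a single one. *)
Require Import Defs.
From mathcomp Require Import all_boot all_algebra.
From mathcomp Require Import boolp classical_sets.
From mathcomp Require Import perm zify ring mpoly.

Set Implicit Arguments.
Unset Strict Implicit.
Unset Printing Implicit Defensive.

(** * Ideals of polynomial rings *)


Section Nullstellensatz.
Import GRing.Theory.
Local Open Scope ring_scope.
Variables (K : closedFieldType) (N : nat).
Implicit Types (J : {mpoly K[N]} -> Prop) (P Q : {mpoly K[N]}).

Definition mideal J : Prop :=
  [/\ J 0, forall P Q, J P -> J Q -> J (P + Q) & forall P Q, J Q -> J (P * Q)].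

Definition mideal_add J Q : {mpoly K[N]} -> Prop :=
  fun P => exists2 R, J R & exists S, P = R + S * Q.

Lemma mideal_addP J Q : mideal J -> mideal (mideal_add J Q).
Proof.
move=> [J0 JD JM]; split.
- by exists 0 => //; exists 0; ring.
- move=> _ _ [R1 JR1 [S1 ->]] [R2 JR2 [S2 ->]].
  by exists (R1 + R2); [exact: JD | exists (S1 + S2); ring].
- move=> P _ [R JR [S ->]].
  by exists (P * R); [exact: JM | exists (P * S); ring].
Qed.

Lemma sub_mideal_add J Q P : J P -> mideal_add J Q P.
Proof. by move=> JP; exists P => //; exists 0; ring. Qed.

Lemma mem_mideal_add J Q : mideal J -> mideal_add J Q Q.
Proof. by case=> J0 _ _; exists 0 => //; exists 1; ring. Qed.

(** If adjoining the first factor gives [1 = R + S * Q] with [R] in [J], multiplying this identity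
    by the product of the other factors puts that product in [J], and induction applies. *)
Lemma proper_mideal_factor J (Qs : seq {mpoly K[N]}) :
  mideal J -> ~ J 1 -> J (\prod_(Q <- Qs) Q) ->
  exists2 Q, Q \in Qs & ~ mideal_add J Q 1.
Proof.
move=> idJ J1; have [J0 JD JM] := idJ; elim: Qs => [|Q Qs IH].
  by rewrite big_nil.
rewrite big_cons => JQ.
have [[R JR [S eq1]]|?] := pselect (mideal_add J Q 1); last first.
  by exists Q => //; rewrite mem_head.
have /IH[Q' Q'in ?] : J (\prod_(Q0 <- Qs) Q0).
  have -> : \prod_(Q0 <- Qs) Q0 =
      (\prod_(Q0 <- Qs) Q0) * R + S * (Q * \prod_(Q0 <- Qs) Q0).
    by rewrite mulrA [X in X + _]mulrC -mulrDl -eq1 mul1r.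
  by apply: JD; apply: JM.
by exists Q' => //; rewrite inE Q'in orbT.
Qed.

(** Over an algebraically closed field [p] splits, so a product of polynomials ['X_i - z] lies in
    [J], and one of these factors can be adjoined. *)
Lemma proper_mideal_root J i (p : {poly K}) :
  mideal J -> ~ J 1 -> p != 0 ->
  J (map_poly (@mpolyC N K) p).['X_i] ->
  exists z, ~ mideal_add J ('X_i - z%:MP) 1.
Proof.
move=> idJ J1 p0 Jp; have [J0 JD JM] := idJ.
have [rs rsE] := closed_field_poly_normal p.
have : J (\prod_(Q <- [seq 'X_i - z%:MP | z <- rs]) Q).
  rewrite big_map; set R := \prod_(_ <- _) _.
  have -> : R = (lead_coef p)^-1%:MP * (map_poly (@mpolyC N K) p).['X_i].
    rewrite {2}rsE map_polyZ hornerZ rmorph_prod horner_prod mulrA -mpolyCM.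
    rewrite mulVf ?lead_coef_eq0 // mul1r; apply: eq_bigr => z _.
    by rewrite rmorphB /= map_polyX map_polyC hornerXsubC.
  exact: JM.
case/(proper_mideal_factor idJ J1) => Q /mapP[z _ ->] ?.
by exists z.
Qed.

(** A weak Nullstellensatz for ideals modulo which every variable is algebraic: the variables are
    specialised one after another while the ideal stays proper. *)
Lemma proper_mideal_point J :
  mideal J -> ~ J 1 ->
  (forall i, exists2 p : {poly K}, p != 0 & J (map_poly (@mpolyC N K) p).['X_i]) ->
  exists t : 'I_N -> K, forall P, J P -> P.@[t] = 0.
Proof.
move=> idJ J1 algJ.
have [J' [idJ' J'1 JJ' J't]] : exists J', [/\ mideal J', ~ J' 1,
    (forall P, J P -> J' P) & forall i, exists z, J' ('X_i - z%:MP)].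
  have [J' [idJ' J'1 JJ' J't]] : exists J', [/\ mideal J', ~ J' 1,
      (forall P, J P -> J' P) &
      forall i, i \in enum 'I_N -> exists z, J' ('X_i - z%:MP)].
    elim: (enum _) => [|i s [J' [idJ' J'1 JJ' J't]]]; first by exists J; split.
    have [p p0 /JJ' Jp] := algJ i.
    have [z J'z] := proper_mideal_root idJ' J'1 p0 Jp.
    exists (mideal_add J' ('X_i - z%:MP)); split => //.
    - exact: mideal_addP.
    - by move=> P /JJ'; exact: sub_mideal_add.
    move=> j; rewrite inE => /orP[/eqP ->|/J't [z' ?]].
      by exists z; exact: mem_mideal_add.
    by exists z'; apply: sub_mideal_add.
  by exists J'; split => // i; apply: J't; rewrite mem_enum.
have [t {}J't] := fin_all_exists J't.
have [J0 JD JM] := idJ'.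
(* Modulo [J'] each variable is the constant [t i], so each polynomial is congruent to its value at
   [t]; a member of [J] with nonzero value would give a unit in [J']. *)
have J'ev P : J' (P - P.@[t]%:MP).
  elim/mpolyind: P => [|c m P _ _ IH]; first by rewrite meval0 mpolyC0 subr0.
  rewrite mevalD mpolyCD mevalZ mpolyCM -mul_mpolyC.
  suff Jm : J' ('X_[m] - ('X_[m]).@[t]%:MP).
    set a := _%:MP; set b := _%:MP in Jm *; set d := _%:MP in IH *.
    have -> : a * 'X_[m] + P - (a * b + d) = a * ('X_[m] - b) + (P - d) by ring.
    by apply: JD => //; apply: JM.
  rewrite mevalX mpolyXE_id.
  elim/big_ind2 : _ => [|x' x y' y Jx Jy|i _].
  - by rewrite subrr.
  - rewrite mpolyCM; set a := x'%:MP in Jx *; set b := y'%:MP in Jy *.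
    have -> : x * y - a * b = y * (x - a) + a * (y - b) by ring.
    by apply: JD; apply: JM.
  elim: (m i) => [|k IHk]; first by rewrite !expr0 subrr.
  rewrite !exprS mpolyCM; set a := (t i)%:MP; set b := (_ ^+ k)%:MP in IHk *.
  have -> : 'X_i * 'X_i ^+ k - a * b =
     'X_i ^+ k * ('X_i - a) + a * ('X_i ^+ k - b) by ring.
  by apply: JD; apply: JM => //; exact: J't.
exists t => P /JJ' JP; apply/eqP/negP => /negP Pt0; apply: J'1.
have -> : 1 = (P.@[t])^-1%:MP * (P + (-1) * (P - (P.@[t])%:MP)).
  have -> : P + (-1) * (P - (P.@[t])%:MP) = (P.@[t])%:MP by ring.
  by rewrite -mpolyCM mulVf.
by apply: (JM); apply: JD => //; exact: JM.
Qed.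

End Nullstellensatz.

(** * Finite morphisms *)


Section PolynomialFunctions.
Import GRing.Theory.
Local Open Scope ring_scope.
Variables (K : closedFieldType) (T : Type) (N : nat) (x : T -> 'I_N -> K).

(** The coordinate ring of the image of [x] in affine [N]-space, realised as functions on [T]. *)
Definition polyfun (f : T -> K) : Prop :=
  exists P : {mpoly K[N]}, forall a, f a = P.@[x a].

Lemma polyfun_cst c : polyfun (fun=> c).
Proof. by exists c%:MP => a; rewrite mevalC. Qed.

Lemma polyfun_coord i : polyfun (x^~ i).
Proof. by exists 'X_i => a; rewrite mevalXU. Qed.

Lemma polyfunD f g : polyfun f -> polyfun g -> polyfun (fun a => f a + g a).
Proof. by move=> [P fP] [Q gQ]; exists (P + Q) => a; rewrite mevalD fP gQ. Qed.

Lemma polyfunM f g : polyfun f -> polyfun g -> polyfun (fun a => f a * g a).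
Proof. by move=> [P fP] [Q gQ]; exists (P * Q) => a; rewrite mevalM fP gQ. Qed.

Lemma polyfunB f g : polyfun f -> polyfun g -> polyfun (fun a => f a - g a).
Proof. by move=> [P fP] [Q gQ]; exists (P - Q) => a; rewrite mevalB fP gQ. Qed.

Lemma polyfun_sum I (r : seq I) (p : pred I) (f : I -> T -> K) :
  (forall i, polyfun (f i)) -> polyfun (fun a => \sum_(i <- r | p i) f i a).
Proof.
move=> fP; elim: r => [|i r IH].
  rewrite (_ : (fun=> _) = fun=> 0); first exact: polyfun_cst.
  by apply/funext => a; rewrite big_nil.
rewrite (_ : (fun=> _) = fun a => (if p i then f i a else 0) + \sum_(i <- r | p i) f i a).
  by apply: polyfunD => //; case: (p i) => //; exact: polyfun_cst.
by apply/funext => a; rewrite big_cons; case: (p i) => //; rewrite add0r.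
Qed.

Lemma polyfun_prod I (r : seq I) (p : pred I) (f : I -> T -> K) :
  (forall i, polyfun (f i)) -> polyfun (fun a => \prod_(i <- r | p i) f i a).
Proof.
move=> fP; elim: r => [|i r IH].
  rewrite (_ : (fun=> _) = fun=> 1); first exact: polyfun_cst.
  by apply/funext => a; rewrite big_nil.
rewrite (_ : (fun=> _) = fun a => (if p i then f i a else 1) * \prod_(i <- r | p i) f i a).
  by apply: polyfunM => //; case: (p i) => //; exact: polyfun_cst.
by apply/funext => a; rewrite big_cons; case: (p i) => //; rewrite mul1r.
Qed.

Lemma polyfun_det n (f : 'I_n -> 'I_n -> T -> K) :
  (forall i j, polyfun (f i j)) -> polyfun (fun a => \det (\matrix_(i, j) f i j a)).
Proof.
move=> fP; rewrite (_ : (fun=> _) = fun a =>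
    \sum_(s : 'S_n) (-1) ^+ s * \prod_i f i (s i) a).
  apply: polyfun_sum => s; apply: polyfunM; first exact: polyfun_cst.
  exact: polyfun_prod.
apply/funext => a; apply: eq_bigr => s _; congr (_ * _).
by apply: eq_bigr => i _; rewrite mxE.
Qed.

End PolynomialFunctions.

Section PolynomialComposition.
Import GRing.Theory.
Local Open Scope ring_scope.

Lemma polyfun_comp (K : closedFieldType) (T T' : Type) (N N' : nat)
    (x : T -> 'I_N -> K) (y : T' -> 'I_N' -> K) (g : T -> T') f :
  (forall i, polyfun x (fun a => y (g a) i)) -> polyfun y f ->
  polyfun x (fun a => f (g a)).
Proof.
move=> gP [Q fQ]; rewrite (_ : (fun=> _) = fun a =>
    \sum_(m <- msupp Q) Q@_m * \prod_i y (g a) i ^+ m i); last first.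
  by apply/funext => a; rewrite fQ mevalE.
apply: polyfun_sum => m; apply: polyfunM; first exact: polyfun_cst.
apply: polyfun_prod => i; have [P PE] := gP i.
by exists (P ^+ m i) => a; rewrite rmorphXn /= -PE.
Qed.

End PolynomialComposition.

Section Horner.
Import GRing.Theory.
Local Open Scope ring_scope.

Lemma meval_horner (K : fieldType) N (p : {poly K}) (i : 'I_N) (v : 'I_N -> K) :
  ((map_poly (@mpolyC N K) p).['X_i]).@[v] = p.[v i].
Proof.
elim/poly_ind: p => [|p c IH]; first by rewrite rmorph0 !horner0 meval0.
rewrite rmorphD rmorphM /= map_polyX map_polyC !hornerE.
by rewrite mevalD mevalM IH mevalXU mevalC.
Qed.

End Horner.

(* The relations [x_expq] make [phi] a finite morphism: the monomials with
   exponents below [q] span the coordinate ring over the pullback of [phi]. *)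
Section FiniteMap.
Import GRing.Theory.
Local Open Scope ring_scope.
Variables (K : closedFieldType) (T : choiceType) (N : nat) (x : T -> 'I_N -> K).
Variables (phi : T -> T) (q : nat) (L : 'I_N -> 'I_N -> T -> K).
Hypothesis x_inj : forall a b, x a =1 x b -> a = b.
Hypothesis x_closed : forall t : 'I_N -> K,
  (forall P : {mpoly K[N]}, (forall a, P.@[x a] = 0) -> P.@[t] = 0) ->
  exists a, x a =1 t.
Hypothesis phi_poly : forall i, polyfun x (fun a => x (phi a) i).
Hypothesis q_gt1 : (1 < q)%N.
Hypothesis L_poly : forall i j, polyfun x (L i j).
Hypothesis x_expq : forall a i, x a i ^+ q = \sum_j L i j (phi a) * x a j.

Local Notation D := {ffun 'I_N -> 'I_q}.
Definition redmon (e : D) a := \prod_i x a i ^+ e i.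

(** Combinations of reduced monomials with coefficients pulled back along [phi]. The coefficients
    are restricted by [C], which will be either no condition or vanishing at a point. *)
Definition redspan (C : (T -> K) -> Prop) (f : T -> K) : Prop :=
  exists b : D -> T -> K,
    (forall e, polyfun x (b e) /\ C (b e)) /\
    forall a, f a = \sum_e b e (phi a) * redmon e a.

Section Redspan.
Variable C : (T -> K) -> Prop.
Hypotheses (C0 : C (fun=> 0))
  (CD : forall f g, C f -> C g -> C (fun a => f a + g a))
  (CM : forall f g, C g -> C (fun a => f a * g a)).

Lemma redspan_sum I (r : seq I) (f : I -> T -> K) :
  (forall i, redspan C (f i)) -> redspan C (fun a => \sum_(i <- r) f i a).
Proof.
move=> /choice[b fb]; exists (fun e a => \sum_(i <- r) b i e a); split=> [e|a].
  split; first by apply: polyfun_sum => i; have [/(_ e)[]] := fb i.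
  elim: r => [|i r IH].
    by rewrite (_ : (fun=> _) = fun=> 0) //; apply/funext => a; rewrite big_nil.
  rewrite (_ : (fun=> _) = fun a => b i e a + \sum_(i <- r) b i e a).
    by apply: CD => //; have [/(_ e)[]] := fb i.
  by apply/funext => a; rewrite big_cons.
under eq_bigr => i _ do rewrite (fb i).2.
by rewrite exchange_big; apply: eq_bigr => e _; rewrite mulr_suml.
Qed.

Lemma redspanM f g : polyfun x f -> redspan C g ->
  redspan C (fun a => f (phi a) * g a).
Proof.
move=> fP [b [bP gE]]; exists (fun e a => f a * b e a); split=> [e|a].
  by have [? ?] := bP e; split; [exact: polyfunM | exact: CM].
by rewrite gE mulr_sumr; apply: eq_bigr => e _; rewrite mulrA.
Qed.

End Redspan.

Let all_fun (f : T -> K) := True.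

(** Induction on the total degree: by [x_expq], a factor [x a i ^+ q] becomes a combination of
    single coordinates, which lowers the degree because [1 < q]. *)
Lemma redspan_mon (m : 'I_N -> nat) :
  redspan all_fun (fun a => \prod_i x a i ^+ m i).
Proof.
have [d] := ubnP (\sum_i m i)%N; elim: d => // d IH in m *; rewrite ltnS => led.
have [/forallP/= ltm|] := boolP [forall i, m i < q]%N.
  pose e : D := [ffun i => Ordinal (ltm i)].
  exists (fun e' _ => (e' == e)%:R); split=> [e'|a].
    by split => //; exact: polyfun_cst.
  rewrite (bigD1 e) //= eqxx mul1r [X in _ + X]big1 ?addr0 => [|e' /negPf->]; last by rewrite mul0r.
  by apply: eq_bigr => i _; rewrite ffunE.
rewrite negb_forall => /existsP[i]; rewrite -leqNgt => leqm.
pose m' k := if k == i then (m i - q)%N else m k.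
rewrite (_ : (fun=> _) = fun a => \sum_j L i j (phi a) *
    \prod_k x a k ^+ (m' k + (k == j))).
  apply: redspan_sum => // j; apply: redspanM => //; apply: IH.
  rewrite big_split /= [X in (_ + X)%N](bigD1 j) //= eqxx.
  rewrite [X in (_ + (_ + X))%N]big1 ?addn0 => [|k /negPf-> //].
  apply: leq_trans led; rewrite (bigD1 i) //= [X in (_ < X)%N](bigD1 i) //= /m' eqxx.
  under eq_bigr => k /negPf -> do [].
  by rewrite addn1 -addSn ltn_add2r; lia.
apply/funext => a; transitivity (x a i ^+ q * \prod_k x a k ^+ m' k).
  rewrite (bigD1 i) //= [in RHS](bigD1 i) //= mulrA /m' eqxx -exprD subnKC //.
  by congr (_ * _); apply: eq_bigr => k /negPf ->.
rewrite x_expq mulr_suml; apply: eq_bigr => j _; rewrite -mulrA; congr (_ * _).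
rewrite [in RHS](bigD1 j) //= [in LHS](bigD1 j) //= eqxx exprD expr1 mulrCA mulrA.
by congr (_ * _); apply: eq_bigr => k /negPf ->; rewrite addn0.
Qed.

Lemma redspan_polyfun f : polyfun x f -> redspan all_fun f.
Proof.
move=> [P fP]; rewrite (_ : f = fun a =>
    \sum_(m <- msupp P) P@_m * \prod_i x a i ^+ m i); last first.
  by apply/funext => a; rewrite fP mevalE.
apply: redspan_sum => // m.
by apply: (@redspanM all_fun _ (fun=> P@_m)) => //; [exact: polyfun_cst | exact: redspan_mon].
Qed.

(** On a fibre of [phi] the coefficients are constants, so all polynomial functions there lie in the
    linear span of the reduced monomials. The indicator functions of the points are among them and
    are independent. *)
Lemma fiber_bound (y : T) (s : seq T) :
  uniq s -> (forall a, a \in s -> phi a = y) -> (size s <= #|{: D}|)%N.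
Proof.
case: s => // a0 s0; set s := a0 :: s0 => us sy.
pose pt (i : 'I_(size s)) := nth a0 s i.
have sep i : exists b : D -> K, forall j,
    (i == j)%:R = \sum_e b e * redmon e (pt j).
  have [f [b [_ fb]] fij] : exists2 f, redspan all_fun f &
      forall j, (i == j)%:R = f (pt j).
    (* Interpolation: [g j] is 1 at [pt i] and 0 at [pt j], by a coordinate that separates the two
       points; the product over [j] is the indicator of [pt i]. *)
    have /fin_all_exists[g gP] (j : 'I_(size s)) : exists g,
        [/\ polyfun x g, g (pt i) = 1 & i != j -> g (pt j) = 0].
      have [<-|nij] := eqVneq i j.
        by exists (fun=> 1); split => //; exact: polyfun_cst.
      have [k neqk] : exists k, x (pt i) k != x (pt j) k.
        apply: contrapT => neq; move: nij; rewrite -(inj_eq val_inj) /=.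
        rewrite -(nth_uniq a0 (ltn_ord i) (ltn_ord j) us) => /eqP; apply.
        apply: x_inj => k; apply: contrapT => /eqP neqk.
        by apply: neq; exists k.
      exists (fun a => (x a k - x (pt j) k) / (x (pt i) k - x (pt j) k)); split.
      - apply: polyfunM; last exact: polyfun_cst.
        by apply: polyfunB; [exact: polyfun_coord | exact: polyfun_cst].
      - by rewrite divff // subr_eq0.
      - by rewrite subrr mul0r.
    exists (fun a => \prod_j g j a) => [|j].
      by apply: redspan_polyfun; apply: polyfun_prod => j; have [] := gP j.
    have [<-|nij] := eqVneq i j.
      by rewrite big1 // => j' _; have [] := gP j'.
    by rewrite (bigD1 j) //=; have [_ _ ->] := gP j; rewrite ?mul0r.
  exists (fun e => b e y) => j; rewrite fij fb.
  by apply: eq_bigr => e _; rewrite (sy (pt j)) // mem_nth.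
have [b bP] := fin_all_exists sep.
(* The identity matrix of size [size s] factors as [B *m E] through dimension [#|{: D}|]. *)
pose E : 'M[K]_(#|{: D}|, size s) := \matrix_(e, j) redmon (enum_val e) (pt j).
pose B : 'M[K]_(size s, #|{: D}|) := \matrix_(i, e) b i (enum_val e).
apply: (@mulmx1_min _ _ _ B E); apply/matrixP => i j; rewrite !mxE bP.
rewrite [in RHS](reindex _ (onW_bij _ (enum_val_bij _))) /=.
by apply: eq_bigr => e _; rewrite !mxE.
Qed.


(* Otherwise the functions [b \o phi] with [b y0 = 0] generate the unit ideal,
   so the reduced monomials satisfy [mon = B(phi a) mon] with [B y0 = 0], and
   [det (1 - B)] vanishes on the image of [phi] but not at [y0]. *)
Lemma finite_image_closed (y0 : T) :
  (forall f, polyfun x f -> (forall a, f (phi a) = 0) -> f y0 = 0) ->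
  exists a, phi a = y0.
Proof.
move=> y0P.
pose C (b : T -> K) := b y0 = 0.
have C0 : C (fun=> 0) by [].
have CD f g : C f -> C g -> C (fun a => f a + g a).
  by rewrite /C => -> ->; rewrite addr0.
have CM f g : C g -> C (fun a => f a * g a) by rewrite /C => ->; rewrite mulr0.
(* The ideal generated by the pullbacks along [phi] of the functions vanishing at [y0]; a common
   zero of it is a preimage of [y0]. *)
pose J (P : {mpoly K[N]}) := redspan C (fun a => P.@[x a]).
have JM P Q : J Q -> J (P * Q).
  move=> [b [bP QE]]; rewrite /J (_ : (fun=> _) = fun a =>
      \sum_(e <- enum {: D}) b e (phi a) * (P.@[x a] * redmon e a)); last first.
    apply/funext => a; rewrite mevalM QE mulr_sumr big_enum.
    by apply: eq_bigr => e _; rewrite mulrCA.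
  apply: redspan_sum => // e; have [bpoly be] := bP e.
  have [b' [b'P E]] : redspan all_fun (fun a => P.@[x a] * redmon e a).
    apply: redspan_polyfun; apply: polyfunM; first by exists P.
    by apply: polyfun_prod => i; exists ('X_i ^+ e i) => a; rewrite rmorphXn /= mevalXU.
  exists (fun e' a => b' e' a * b e a); split=> [e'|a].
    by split; [apply: polyfunM => //; have [] := b'P e' | exact: CM].
  by rewrite E mulr_sumr; apply: eq_bigr => e' _; rewrite mulrA [b' _ _ * _]mulrC.
have idJ : mideal J.
  split=> //.
    exists (fun _ _ => 0); split=> [e|a]; first by split=> //; exact: polyfun_cst.
    by rewrite meval0 big1 // => e _; rewrite mul0r.
  move=> P Q [b [bP PE]] [b' [b'P QE]].
  exists (fun e a => b e a + b' e a); split=> [e|a].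
    have [? ?] := bP e; have [? ?] := b'P e.
    by split; [exact: polyfunD | exact: CD].
  by rewrite mevalD PE QE -big_split; apply: eq_bigr => e _; rewrite mulrDl.
pose mon (e : D) : {mpoly K[N]} := \prod_i 'X_i ^+ e i.
have monE e a : (mon e).@[x a] = redmon e a.
  by rewrite rmorph_prod; apply: eq_bigr => i _; rewrite rmorphXn /= mevalXU.
have [J1|J1] := pselect (J 1).
  have /fin_all_exists[B BP] e : exists b : D -> T -> K,
      (forall e', polyfun x (b e') /\ b e' y0 = 0) /\
      forall a, redmon e a = \sum_e' b e' (phi a) * redmon e' a.
    have [b [bP bE]] : J (mon e) by rewrite -[mon e]mulr1; exact: JM.
    by exists b; split=> // a; rewrite -monE bE.
  pose M a : 'M[K]_#|{: D}| :=
    \matrix_(i, j) ((i == j)%:R - B (enum_val i) (enum_val j) a).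
  have : \det (M y0) = 0.
    apply: (y0P (fun a => \det (M a))).
      apply: polyfun_det => i j; apply: polyfunB; first exact: polyfun_cst.
      by have [/(_ (enum_val j))[]] := BP (enum_val i).
    move=> a; apply/eqP; rewrite -det_tr; apply/det0P.
    exists (\row_j redmon (enum_val j) a).
      (* The monomial with all exponents 0 is 1, so the row of reduced monomials at [a] is a nonzero
         kernel vector. *)
      pose e0 : D := [ffun=> Ordinal (ltnW q_gt1)].
      apply/eqP => /rowP/(_ (enum_rank e0)); rewrite !mxE enum_rankK /redmon.
      by rewrite big1 => [/eqP|i _]; rewrite ?oner_eq0 // ffunE.
    apply/rowP => j; rewrite !mxE; have [_ /(_ a) monj] := BP (enum_val j).
    under eq_bigr => k _ do rewrite !mxE mulrBr.
    rewrite sumrB (bigD1 j) //= eqxx mulr1 [X in _ + X - _]big1 => [|k ne].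
      rewrite addr0 monj [X in X - _](reindex _ (onW_bij _ (enum_val_bij D))) /=.
      by apply/eqP; rewrite subr_eq0; apply/eqP/eq_bigr => k _; rewrite mulrC.
    by rewrite eq_sym (negPf ne) mulr0.
  rewrite (_ : M y0 = 1%:M) ?det1 => [/eqP|]; first by rewrite oner_eq0.
  apply/matrixP => i j; rewrite !mxE.
  by have [/(_ (enum_val j))[_ ->]] := BP (enum_val i); rewrite subr0.
have JX f : polyfun x f -> f y0 = 0 ->
    exists2 P : {mpoly K[N]}, J P & forall a, P.@[x a] = f (phi a).
  move=> fP f0; have [P PE] := polyfun_comp phi_poly fP; exists P => //.
  have [b [bP bE]] := redspan_polyfun (polyfun_cst x 1).
  exists (fun e a => f a * b e a); split=> [e|a].
    by split; [apply: polyfunM => //; have [] := bP e | rewrite /C f0 mul0r].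
  rewrite -PE -[LHS]mulr1 (bE a) mulr_sumr.
  by apply: eq_bigr => e _; rewrite mulrA.
(* Each coordinate is algebraic modulo [J]: there are more powers ['X_i ^+ k] with [k <= #|{: D}|]
   than reduced monomials, so their coefficient rows at [y0] satisfy a linear relation [v], which
   gives a nonzero polynomial in ['X_i] lying in [J]. *)
have [i|t tP] := proper_mideal_point idJ J1.
  have /fin_all_exists[b bP] (k : 'I_#|{: D}|.+1) : exists b : D -> T -> K,
      (forall e, polyfun x (b e)) /\
      forall a, x a i ^+ k = \sum_e b e (phi a) * redmon e a.
    have [|b [bP bE]] := @redspan_polyfun (fun a => x a i ^+ k).
      by exists ('X_i ^+ k) => a; rewrite rmorphXn /= mevalXU.
    by exists b; split=> // e; have [] := bP e.
  pose W : 'M[K]_(#|{: D}|.+1, #|{: D}|) := \matrix_(k, e) b k (enum_val e) y0.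
  have /rowV0Pn[v /sub_kermxP vW v0] : kermx W != 0.
    by rewrite kermx_eq0 /row_free neq_ltn ltnS rank_leq_col.
  exists (\sum_k v 0 k *: 'X^k).
    apply: contraNneq v0 => p0; apply/eqP/rowP => k.
    have /(congr1 (fun p : {poly K} => p`_k)) := p0.
    rewrite coef0 coef_sum (bigD1 k) //= coefZ coefXn eqxx mulr1 big1.
      by rewrite addr0 mxE.
    by move=> k' ne; rewrite coefZ coefXn (inj_eq val_inj) eq_sym (negPf ne) mulr0.
  exists (fun e a => \sum_k v 0 k * b k e a); split=> [e|a].
    split.
      apply: polyfun_sum => k; apply: polyfunM; first exact: polyfun_cst.
      by have [] := bP k.
    have /rowP/(_ (enum_rank e)) := vW; rewrite !mxE => vWe.
    by rewrite /C -[RHS]vWe; apply: eq_bigr => k _; rewrite mxE enum_rankK.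
  rewrite meval_horner horner_sum.
  under [RHS]eq_bigr => e _ do rewrite mulr_suml.
  rewrite exchange_big; apply: eq_bigr => k _ /=.
  rewrite hornerZ hornerXn; have [_ ->] := bP k; rewrite mulr_sumr.
  by apply: eq_bigr => e _; rewrite mulrA.
(* Polynomials vanishing on the image of [x] belong to [J] with zero coefficients, so they vanish at
   [t], and [t] is a point of that closed image. *)
have [a xa] : exists a, x a =1 t.
  apply: x_closed => P P0; apply: tP.
  exists (fun _ _ => 0); split=> [e|a]; first by split=> //; exact: polyfun_cst.
  by rewrite P0 big1 // => e _; rewrite mul0r.
exists a; apply: x_inj => i; apply/eqP; rewrite -subr_eq0; apply/eqP.
have [||P JP PE] := JX (fun b => x b i - x y0 i).
- by apply: polyfunB; [exact: polyfun_coord | exact: polyfun_cst].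
- by rewrite subrr.
by rewrite -PE (meval_eq _ xa) tP.
Qed.

End FiniteMap.

(** * Twisted orbits *)


Lemma size_fiber_bound (P S : eqType) (ps : seq P) (s : seq S) (f : P -> S) d :
  uniq s -> (forall p, p \in ps -> f p \in s) ->
  (forall y, (size [seq p <- ps | f p == y] <= d)%N) -> (size ps <= d * size s)%N.
Proof.
move=> us fs le_d.
have -> : size ps = (\sum_(y <- s) size [seq p <- ps | f p == y])%N.
  under eq_bigr => y _ do rewrite size_filter -sum1_count.
  rewrite (exchange_big_dep predT) //= -sum1_size.
  apply: eq_big_seq => p /fs fp; rewrite sum1_count.
  by rewrite (@eq_count _ _ (pred1 (f p))) ?count_uniq_mem ?fp // => y; rewrite /= eq_sym.
rewrite -[size s]count_predT -iter_addn_0 -big_const_seq.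
by apply: leq_sum => y _; exact: le_d.
Qed.

Section TwistedOrbits.
Local Open Scope group_scope.
Variables (G : groupType) (sigma : G -> G).
Hypothesis sigmaM : {morph sigma : a b / a * b}.

Definition twist (c a : G) : G := a^-1 * c * sigma a.

Definition tconj (c d : G) : Prop := exists a, twist c a = d.

Lemma sigma1 : sigma 1 = 1.
Proof. by apply: (mulgI (sigma 1)); rewrite -sigmaM !mulg1. Qed.

Lemma twistM c a b : twist (twist c a) b = twist c (a * b).
Proof. by rewrite /twist sigmaM invgM !mulgA. Qed.

Lemma tconj_refl c : tconj c c.
Proof. by exists 1; rewrite /twist sigma1 invg1 mul1g mulg1. Qed.

Lemma tconj_trans c d e : tconj c d -> tconj d e -> tconj c e.
Proof. by move=> [a <-] [b <-]; exists (a * b); rewrite twistM. Qed.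

Lemma tconj_sym c d : tconj c d -> tconj d c.
Proof.
move=> [a <-]; exists a^-1.
by rewrite twistM mulgV /twist sigma1 invg1 mul1g mulg1.
Qed.

Variables (K : closedFieldType) (N : nat) (x : G -> 'I_N -> K) (q : nat).
Variable (L : G -> 'I_N -> 'I_N -> G -> K).
Hypothesis x_inj : forall a b, x a =1 x b -> a = b.
Hypothesis x_closed : forall t : 'I_N -> K,
  (forall P : {mpoly K[N]}, (forall a, P.@[x a] = 0%R) -> P.@[t] = 0%R) ->
  exists a, x a =1 t.
Hypothesis twist_poly : forall c i, polyfun x (fun a => x (twist c a) i).
Hypothesis q_gt1 : (1 < q)%N.
Hypothesis L_poly : forall c i j, polyfun x (L c i j).
Hypothesis x_expq : forall c a i,
  (x a i ^+ q = \sum_j L c i j (twist c a) * x a j)%R.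
(** To be instantiated by the fixed points of a power of [sigma] that fixes every element of
    [cs]. *)
Hypothesis finite_stable : forall cs : seq G, exists s : seq G,
  [/\ uniq s, 0 < size s &
      forall c a, c \in cs -> a \in s -> twist c a \in s].

Definition poly_closed (Z : G -> Prop) : Prop := forall y,
  (forall f, polyfun x f -> (forall a, Z a -> f a = 0%R) -> f y = 0%R) -> Z y.

Hypothesis conn : forall Z1 Z2 : G -> Prop, poly_closed Z1 -> poly_closed Z2 ->
  (forall a, Z1 a \/ Z2 a) -> (forall a, Z1 a -> Z2 a -> False) ->
  (forall a, Z1 a) \/ (forall a, Z2 a).

(** The orbit is the image of [twist c], a finite morphism by [x_expq]. *)
Lemma tconj_closed c : poly_closed (tconj c).
Proof.
move=> y yP; apply: (finite_image_closed x_inj x_closed _ q_gt1 (L_poly c)) => //.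
by move=> f fP f0; apply: yP => // _ [a <-].
Qed.

Lemma poly_closedU Z1 Z2 : poly_closed Z1 -> poly_closed Z2 ->
  poly_closed (fun a => Z1 a \/ Z2 a).
Proof.
move=> c1 c2 y yP; apply: contrapT => /not_orP[].
move=> /(contra_not (c1 y))/existsNP[f /not_implyP[fP /not_implyP[fZ /eqP fy]]].
move=> /(contra_not (c2 y))/existsNP[g /not_implyP[gP /not_implyP[gZ /eqP gy]]].
suff : (f y * g y = 0)%R by move=> /eqP; rewrite GRing.mulf_eq0 (negPf fy) (negPf gy).
apply: (yP (fun a => f a * g a)%R); first exact: polyfunM.
by move=> a [/fZ ->|/gZ ->]; rewrite ?GRing.mul0r ?GRing.mulr0.
Qed.

Lemma tconj_seq_closed (cs : seq G) :
  poly_closed (fun a => exists2 c, c \in cs & tconj c a).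
Proof.
elim: cs => [|c cs IH] y yP.
  have /eqP := yP (fun=> 1%R) (polyfun_cst _ _) (fun a '(ex_intro2 _ H _) => False_rect _ (notF H)).
  by rewrite GRing.oner_eq0.
have : tconj c y \/ exists2 c, c \in cs & tconj c y.
  apply: (poly_closedU (@tconj_closed c) IH) => f fP fZ; apply: yP => // a [d].
  rewrite inE => /orP[/eqP -> |dcs] ?; apply: fZ; first by left.
  by right; exists d.
case=> [?|[d dcs ?]]; first by exists c => //; rewrite mem_head.
by exists d => //; rewrite inE dcs orbT.
Qed.

(* Pigeonhole: [(c, a) |-> twist c a] maps [cs] x [s] to [s] with fibres of
   size at most [#|'I_q ^ N|]. *)
Lemma tconj_bound (cs : seq G) :
  uniq cs -> (forall c d, c \in cs -> d \in cs -> tconj c d -> c = d) ->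
  (size cs <= #|{: {ffun 'I_N -> 'I_q}}|)%N.
Proof.
move=> ucs csP; have [s [us s0 sP]] := finite_stable cs.
rewrite -(leq_pmul2r s0) -(size_allpairs pair).
apply: (size_fiber_bound (f := fun p => twist p.1 p.2)) => // [p|y].
  by case/allpairsP=> -[c a] /= [ccs ain ->]; exact: sP.
set ps := [seq p <- _ | _].
have psP p : p \in ps -> p.1 \in cs /\ twist p.1 p.2 = y.
  by rewrite mem_filter => /andP[/eqP <-] /allpairsP[[c a] /= [? _ ->]].
have ups : uniq ps.
  by apply/filter_uniq/allpairs_uniq => // -[? ?] [? ?] _ _ [-> ->].
clearbody ps; case: ps => // -[c a0] ps in psP ups *.
(* Representatives of distinct orbits have no common value, so all pairs over [y] share the first
   component [c] and their second components lie in one fibre of [twist c]. *)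
have cP p : p \in (c, a0) :: ps -> p.1 = c.
  move=> /psP[p1 py]; have [ccs cy] := psP _ (mem_head _ _).
  apply: csP => //; apply: tconj_trans (ex_intro _ _ py) _.
  by apply: tconj_sym; exists a0.
rewrite -(size_map snd).
apply: (@fiber_bound _ _ _ _ _ _ _ x_inj q_gt1 (L_poly c) (x_expq c) y);
  last first => [a /mapP[p pin ->]|].
  by have [_] := psP _ pin; rewrite (cP _ pin).
by rewrite map_inj_in_uniq // => -[? ?] [? ?] /cP/= -> /cP/= -> /= -> //.
Qed.

Lemma lang_of_connected c : exists a, c = a^-1 * sigma a.
Proof.
suff [a <-] : tconj 1 c by exists a; rewrite /twist mulg1.
(* Finitely many representatives [cs] cover everything outside the orbit of 1; both that orbit and
   the union of the others are closed, so connectedness applies. *)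
have [cs [csP cs1]] : exists cs, (forall d, exists2 c, c \in 1 :: cs & tconj c d) /\
    forall c, c \in cs -> ~ tconj 1 c.
  (* Otherwise a list of pairwise inequivalent elements starting with 1 can be prolonged to any
     length, against [tconj_bound]. *)
  apply: contrapT => nocs.
  have long n : exists cs, [/\ size cs = n, uniq (1 :: cs) &
      forall c d, c \in 1 :: cs -> d \in 1 :: cs -> tconj c d -> c = d].
    elim: n => [|n [cs [scs ucs csP]]].
      by exists [::]; split=> // c' d; rewrite !inE => /eqP -> /eqP ->.
    have [d dP] : exists d, forall c, c \in 1 :: cs -> ~ tconj c d.
      apply: contrapT => nod; apply: nocs; exists cs; split=> [d|c' c'in c1].
        apply: contrapT => H; apply: nod; exists d => c' c'in c'd.
        by apply: H; exists c'.
      have := csP _ _ (mem_head _ _) _ c1; rewrite inE c'in orbT => /(_ isT) e.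
      by move: ucs; rewrite /= e c'in.
    exists (rcons cs d); split; first by rewrite size_rcons scs.
      rewrite -rcons_cons rcons_uniq ucs andbT.
      by apply/negP => /dP; apply; exact: tconj_refl.
    move=> c1 c2; rewrite -rcons_cons !mem_rcons !(in_cons d).
    move=> /orP[/eqP->|c1in] /orP[/eqP->|c2in] //.
    - by move=> /tconj_sym /dP; case.
    - by move=> /dP; case.
    - exact: csP.
  have [cs [scs ucs csP]] := long #|{: {ffun 'I_N -> 'I_q}}|.
  by have := tconj_bound ucs csP; rewrite /= scs ltnn.
have [|||] := conn (@tconj_closed 1) (@tconj_seq_closed cs); [| |by apply|].
- move=> a; have [d] := csP a; rewrite inE => /orP[/eqP->|]; first by left.
  by move=> dcs da; right; exists d.
- move=> a a1 [d dcs da]; apply: (cs1 d) => //.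
  by apply: tconj_trans a1 _; exact: tconj_sym.
- move=> /(_ 1)[d dcs d1]; case: (cs1 d dcs); exact: tconj_sym.
Qed.

End TwistedOrbits.

(** * Regular functions on linear algebraic groups *)


Section MatrixCoordinates.
Import GRing.Theory.
Local Open Scope ring_scope.
Variables (K : closedFieldType).
Implicit Types X Y Z : lin_alg_group K.

Lemma lag_mxM X (a b : X) : lag_mx (a * b)%g = lag_mx a *m lag_mx b.
Proof. by rewrite /lag_mx valM. Qed.

Lemma lag_mxV X (a : X) : lag_mx (a^-1)%g = invmx (lag_mx a).
Proof. by rewrite /lag_mx gmulfV. Qed.

Lemma lag_mx_unit X (a : X) : lag_mx a \in unitmx.
Proof. exact: (valP (val a)). Qed.

Lemma lag_det_neq0 X (a : X) : \det (lag_mx a) != 0.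
Proof. by have := lag_mx_unit a; rewrite unitmxE unitfE. Qed.

Lemma lag_mx_inj X : injective (@lag_mx K X).
Proof. by move=> a b ab; apply/val_inj/val_inj. Qed.

(** The general linear group is seen as a closed subset of affine space of dimension [n * n + 1]:
    index [ord0] carries the inverse determinant, the others the entries. *)
Definition mx_idx n (i j : 'I_n) : 'I_(n * n).+1 := lift ord0 (mxvec_index i j).

Definition lag_coord X (a : X) (i : 'I_(lag_dim X * lag_dim X).+1) : K :=
  if unlift ord0 i is Some k then mxvec (lag_mx a) ord0 k else (\det (lag_mx a))^-1.
Arguments lag_coord : clear implicits.

Lemma coord_mx X (a : X) i j : lag_coord X a (mx_idx i j) = lag_mx a i j.
Proof. by rewrite /lag_coord liftK mxvecE. Qed.

Lemma coord_det X (a : X) : lag_coord X a ord0 = (\det (lag_mx a))^-1.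
Proof. by rewrite /lag_coord unlift_none. Qed.

Lemma coord_ind X (P : 'I_(lag_dim X * lag_dim X).+1 -> Prop) :
  P ord0 -> (forall i j, P (mx_idx i j)) -> forall i, P i.
Proof.
move=> P0 P1 i; have [k ->|-> //] := unliftP ord0 i.
by case/mxvec_indexP: k => i' j'; exact: P1.
Qed.

Lemma coord_inj X (a b : X) : lag_coord X a =1 lag_coord X b -> a = b.
Proof.
move=> ab; apply: lag_mx_inj; apply/matrixP => i j.
by have := ab (mx_idx i j); rewrite !coord_mx.
Qed.

Section Meval.
Variables (T : Type) (N : nat) (x : T -> 'I_N -> K) (n : nat).

Lemma polyfun_meval_mx (M : T -> 'M[K]_n) (P : {mpoly K[n * n]}) :
  (forall i j, polyfun x (fun a => M a i j)) ->
  polyfun x (fun a => meval_mx P (M a)).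
Proof.
move=> MP; apply: (@polyfun_comp _ _ _ _ _ _ (fun A k => mxvec A ord0 k)) => [k|].
  case/mxvec_indexP: k => i j.
  by rewrite (_ : (fun=> _) = fun a => M a i j) //; apply/funext => a; rewrite mxvecE.
by exists P.
Qed.

Lemma polyfun_detmx (M : T -> 'M[K]_n) :
  (forall i j, polyfun x (fun a => M a i j)) -> polyfun x (fun a => \det (M a)).
Proof.
move=> MP; rewrite (_ : (fun=> _) = fun a => \det (\matrix_(i, j) M a i j)).
  exact: polyfun_det.
by apply/funext => a; congr (\det _); apply/matrixP => i j; rewrite mxE.
Qed.

Lemma polyfun_mulmx (M M' : T -> 'M[K]_n) :
  (forall i j, polyfun x (fun a => M a i j)) ->
  (forall i j, polyfun x (fun a => M' a i j)) ->
  forall i j, polyfun x (fun a => (M a *m M' a) i j).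
Proof.
move=> MP MP' i j; rewrite (_ : (fun=> _) = fun a => \sum_k M a i k * M' a k j).
  by apply: polyfun_sum => k; exact: polyfunM.
by apply/funext => a; rewrite mxE.
Qed.

End Meval.

Lemma polyfun_lag_mx X i j : polyfun (lag_coord X) (fun a => lag_mx a i j).
Proof. by exists 'X_(mx_idx i j) => a; rewrite mevalXU coord_mx. Qed.

Lemma polyfun_lag_det X : polyfun (lag_coord X) (fun a => (\det (lag_mx a))^-1).
Proof. by exists 'X_ord0 => a; rewrite mevalXU coord_det. Qed.

Lemma polyfun_lag_mxV X i j : polyfun (lag_coord X) (fun a => lag_mx (a^-1)%g i j).
Proof.
rewrite (_ : (fun=> _) = fun a => (\det (lag_mx a))^-1 * (\adj (lag_mx a)) i j).
  apply: polyfunM; first exact: polyfun_lag_det.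
  rewrite (_ : (fun=> _) = fun a : X =>
      (-1) ^+ (j + i) * \det (row' j (col' i (lag_mx a)))).
    apply: polyfunM; first exact: polyfun_cst.
    apply: polyfun_detmx => k l.
    rewrite (_ : (fun=> _) = fun a : X => lag_mx a (lift j k) (lift i l)).
      exact: polyfun_lag_mx.
    by apply/funext => a; rewrite !mxE.
  by apply/funext => a; rewrite mxE.
by apply/funext => a; rewrite lag_mxV /invmx lag_mx_unit mxE.
Qed.

(** Regularity expressed through pullback of functions, which makes composition immediate. *)
Definition regmap X Y (g : X -> Y) : Prop :=
  forall f, polyfun (lag_coord Y) f -> polyfun (lag_coord X) (fun a => f (g a)).

Lemma regmap_mx X Y (g : X -> Y) :
  (forall i j, polyfun (lag_coord X) (fun a => lag_mx (g a) i j)) ->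
  polyfun (lag_coord X) (fun a => (\det (lag_mx (g a)))^-1) -> regmap g.
Proof.
move=> gx gd f; apply: polyfun_comp; apply: coord_ind => [|i j].
  by rewrite (_ : (fun=> _) = fun a => (\det (lag_mx (g a)))^-1) //;
    apply/funext => a; rewrite coord_det.
rewrite (_ : (fun=> _) = fun a => lag_mx (g a) i j) //.
by apply/funext => a; rewrite coord_mx.
Qed.

Lemma regmap_cst X Y (b : Y) : regmap (fun _ : X => b).
Proof. by move=> f _; exact: polyfun_cst. Qed.

Lemma regmap_comp X Y Z (g : X -> Y) (h : Y -> Z) :
  regmap g -> regmap h -> regmap (h \o g).
Proof. by move=> gP hP f /hP/gP. Qed.

Lemma regmapM X Y (g h : X -> Y) :
  regmap g -> regmap h -> regmap (fun a => g a * h a)%g.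
Proof.
move=> gP hP; apply: regmap_mx => [i j|].
  rewrite (_ : (fun=> _) = fun a => (lag_mx (g a) *m lag_mx (h a)) i j).
    apply: polyfun_mulmx => k l; first exact: gP (polyfun_lag_mx k l).
    exact: hP (polyfun_lag_mx k l).
  by apply/funext => a; rewrite lag_mxM.
rewrite (_ : (fun=> _) = fun a => (\det (lag_mx (g a)))^-1 * (\det (lag_mx (h a)))^-1).
  by apply: polyfunM; [exact: gP (polyfun_lag_det Y) | exact: hP (polyfun_lag_det Y)].
by apply/funext => a; rewrite lag_mxM det_mulmx invfM.
Qed.

Lemma regmapV X : regmap (fun a : X => a^-1)%g.
Proof.
apply: regmap_mx => [i j|]; first exact: polyfun_lag_mxV.
rewrite (_ : (fun=> _) = fun a : X => \det (lag_mx a)).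
  by apply: polyfun_detmx; exact: polyfun_lag_mx.
by apply/funext => a; rewrite lag_mxV det_inv invrK.
Qed.

Lemma regmap_morphism X Y (f : X -> Y) : lag_morphism f -> regmap f.
Proof.
move=> [fM [P [r fP]]].
have f1 : f 1%g = 1%g by apply: (mulgI (f 1%g)); rewrite -fM !mulg1.
have fV a : f (a^-1)%g = ((f a)^-1)%g.
  by apply: (mulgI (f a)); rewrite -fM !mulgV f1.
have fx i j : polyfun (lag_coord X) (fun a => lag_mx (f a) i j).
  rewrite (_ : (fun=> _) = fun a =>
      meval_mx (P i j) (lag_mx a) * ((\det (lag_mx a))^-1) ^+ r).
    apply: polyfunM; first by apply: polyfun_meval_mx; exact: polyfun_lag_mx.
    by have [Q QE] := polyfun_lag_det X; exists (Q ^+ r) => a; rewrite rmorphXn /= -QE.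
  by apply/funext => a; rewrite fP exprVn.
apply: regmap_mx => //.
(* As [f] is a homomorphism, the inverse determinant of [f a] is the determinant of [f a^-1],
   polynomial in the coordinates of [a]. *)
rewrite (_ : (fun=> _) = fun a => \det (lag_mx (f (a^-1)%g))).
  by apply: polyfun_detmx => i j; exact: (regmapV (fx i j)).
by apply/funext => a; rewrite fV lag_mxV det_inv.
Qed.

(** Clears the inverse determinant, as [zariski_closed] only admits polynomials in the matrix
    entries. *)
Lemma polyfun_coordP X f : polyfun (lag_coord X) f ->
  exists (Q : {mpoly K[lag_dim X * lag_dim X]}) r,
    forall a, f a = meval_mx Q (lag_mx a) / \det (lag_mx a) ^+ r.
Proof.
pose R (f : X -> K) := exists (Q : {mpoly K[lag_dim X * lag_dim X]}) r,
    forall a, f a = meval_mx Q (lag_mx a) / \det (lag_mx a) ^+ r.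
have [d dE] : exists d : {mpoly K[lag_dim X * lag_dim X]},
    forall A, \det A = meval_mx d A.
  have [|d dE] := @polyfun_detmx _ _ (fun A k => mxvec A ord0 k) (lag_dim X) id.
    by move=> i j; exists 'X_(mxvec_index i j) => A; rewrite mevalXU mxvecE.
  by exists d.
have Rc c : R (fun=> c).
  by exists c%:MP, 0%N => a; rewrite /meval_mx mevalC expr0 divr1.
have RD g h : R g -> R h -> R (fun a => g a + h a).
  move=> [P [r gP]] [Q [s hQ]]; exists (P * d ^+ s + Q * d ^+ r), (r + s)%N => a.
  rewrite gP hQ /meval_mx mevalD !mevalM !rmorphXn /= -/(meval_mx d _) -dE.
  by have d0 := lag_det_neq0 a; rewrite exprD; field; rewrite !expf_neq0.
have RM g h : R g -> R h -> R (fun a => g a * h a).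
  move=> [P [r gP]] [Q [s hQ]]; exists (P * Q), (r + s)%N => a.
  by rewrite gP hQ /meval_mx mevalM exprD invfM mulrACA.
have Rx i : R (fun a => lag_coord X a i).
  move: i; apply: coord_ind => [|i j].
    by exists 1, 1%N => a; rewrite coord_det /meval_mx meval1 mul1r expr1.
  by exists 'X_(mxvec_index i j), 0%N => a; rewrite coord_mx /meval_mx mevalXU mxvecE expr0 divr1.
move=> [P fP]; suff: R (fun a => P.@[lag_coord X a]).
  by move=> [Q [r QE]]; exists Q, r => a; rewrite fP QE.
elim/mpolyind: P {fP} => [|c m P _ _ IH].
  by rewrite (_ : (fun=> _) = fun=> 0) //; apply/funext => a; rewrite meval0.
rewrite (_ : (fun=> _) = fun a => c * \prod_i lag_coord X a i ^+ m i + P.@[lag_coord X a]).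
  apply: (RD) => //; apply: (RM) => //.
  elim: (index_enum _) => [|i s IHs].
    by rewrite (_ : (fun=> _) = fun=> 1) //; apply/funext => a; rewrite big_nil.
  rewrite (_ : (fun=> _) = fun a => lag_coord X a i ^+ m i * \prod_(i <- s) lag_coord X a i ^+ m i).
    apply: (RM) => //; elim: (m i) => [|k IHk].
      by rewrite (_ : (fun=> _) = fun=> 1) //; apply/funext => a; rewrite expr0.
    rewrite (_ : (fun=> _) = fun a => lag_coord X a i * lag_coord X a i ^+ k).
      exact: RM.
    by apply/funext => a; rewrite exprS.
  by apply/funext => a; rewrite big_cons.
by apply/funext => a; rewrite mevalD mevalZ mevalX.
Qed.

(** The relation between [ord0] and the determinant makes the matrix read off from [t] invertible,
    and the equations defining [X] put it in [X]. *)
Lemma coord_closed X (t : 'I_(lag_dim X * lag_dim X).+1 -> K) :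
  (forall P : {mpoly K[(lag_dim X * lag_dim X).+1]},
    (forall a, P.@[lag_coord X a] = 0) -> P.@[t] = 0) ->
  exists a, lag_coord X a =1 t.
Proof.
move=> tP.
have {}tP (f : ('I_(lag_dim X * lag_dim X).+1 -> K) -> K) : polyfun id f ->
    (forall a, f (lag_coord X a) = 0) -> f t = 0.
  by move=> [P fP] fX; rewrite fP; apply: tP => a; rewrite -fP.
pose M (v : 'I_(lag_dim X * lag_dim X).+1 -> K) : 'M[K]_(lag_dim X) :=
  \matrix_(i, j) v (mx_idx i j).
have Mpoly i j : polyfun id (fun v => M v i j).
  by exists 'X_(mx_idx i j) => v; rewrite mxE mevalXU.
have MX a : M (lag_coord X a) = lag_mx a.
  by apply/matrixP => i j; rewrite mxE coord_mx.
have t0 : t ord0 * \det (M t) = 1.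
  apply/eqP; rewrite -subr_eq0; apply/eqP.
  apply: (tP (fun v => v ord0 * \det (M v) - 1)).
    apply: polyfunB; last exact: polyfun_cst.
    by apply: polyfunM; [exact: polyfun_coord | exact: polyfun_detmx].
  by move=> a; rewrite MX coord_det mulVf ?subrr // lag_det_neq0.
have uM : M t \in unitmx.
  by rewrite unitmxE unitfE; apply: contra_eq_neq t0 => ->; rewrite mulr0 eq_sym oner_eq0.
have [S XS] := lag_closed X.
have XM : subgroup_set (lag_pts X) (mk_GL uM).
  rewrite XS => P SP /=; apply: (tP (fun v => meval_mx P (M v))).
    exact: polyfun_meval_mx.
  move=> a; rewrite MX; have := eltP a.
  by rewrite {1}XS; apply.
exists (to_elt XM); apply: coord_ind => [|i j].
  rewrite coord_det; apply: (mulIf (x := \det (M t))).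
    by rewrite -unitfE -unitmxE.
  by rewrite t0 mulVf // -unitfE -unitmxE.
by rewrite coord_mx mxE.
Qed.

End MatrixCoordinates.

(** * The Lang-Steinberg theorem *)


Section LinearRelations.
Import GRing.Theory.
Local Open Scope ring_scope.
Variables (K : closedFieldType) (T : Type) (N : nat) (x : T -> 'I_N -> K).
Variable phi : T -> T.

(** The shape of the right-hand side of [x_expq]. *)
Definition lincomb (h : T -> K) : Prop := exists L : 'I_N -> T -> K,
  (forall j, polyfun x (L j)) /\ forall a, h a = \sum_j L j (phi a) * x a j.

Lemma lincomb_coord j : lincomb (x^~ j).
Proof.
exists (fun k _ => (k == j)%:R); split=> [k|a]; first exact: polyfun_cst.
rewrite (bigD1 j) //= eqxx mul1r big1 ?addr0 // => k /negPf ->.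
by rewrite mul0r.
Qed.

Lemma lincombM f h : polyfun x f -> lincomb h -> lincomb (fun a => f (phi a) * h a).
Proof.
move=> fP [L [LP hE]]; exists (fun j a => f a * L j a); split=> [j|a].
  exact: polyfunM.
by rewrite hE mulr_sumr; apply: eq_bigr => j _; rewrite mulrA.
Qed.

Lemma lincomb_sum (I : finType) (h : I -> T -> K) :
  (forall i, lincomb (h i)) -> lincomb (fun a => \sum_i h i a).
Proof.
move=> /fin_all_exists[L LP]; exists (fun j a => \sum_i L i j a); split=> [j|a].
  by apply: polyfun_sum => i; have [] := LP i.
under eq_bigr => i _ do rewrite (LP i).2.
by rewrite exchange_big; apply: eq_bigr => j _; rewrite mulr_suml.
Qed.

End LinearRelations.

Section IteratedEndomorphism.
Local Open Scope group_scope.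
Variables (G : groupType) (sigma : G -> G).
Hypothesis sigmaM : {morph sigma : a b / a * b}.

Lemma iter_morph n : {morph iter n sigma : a b / a * b}.
Proof. by elim: n => // n IH a b; rewrite !iterS IH sigmaM. Qed.

Lemma morph_invg (f : G -> G) a : {morph f : a b / a * b} -> f a^-1 = (f a)^-1.
Proof.
move=> fM; apply: (mulgI (f a)); rewrite -fM !mulgV.
by apply: (mulgI (f 1)); rewrite -fM !mulg1.
Qed.

(** For an endomorphism [sigma] this is the twisted norm, the product of [y], [sigma y], and so on
    up to [iter n.-1 sigma y]. *)
Definition twnorm n y := iter n (fun z => y * sigma z) 1.

(** With [y = twist sigma c a] one has [sigma a = c^-1 * a * y]; iterating this accumulates the
    norms of [c] and [y]. *)
Lemma iter_twist n c a :
  iter n sigma a = (twnorm n c)^-1 * a * twnorm n (twist sigma c a).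
Proof.
elim: n => [|n IH]; first by rewrite /= invg1 mul1g mulg1.
rewrite iterS IH !sigmaM (morph_invg _ sigmaM) /= invgM /twist.
by rewrite !mulgA !mulgK mulgVK.
Qed.

End IteratedEndomorphism.

Section FiniteFixedPoints.
Import GRing.Theory.
Local Open Scope ring_scope.

(** The entries are roots of ['X^q - 'X], so only finitely many matrices can occur. *)
Lemma finite_expn_fixed (K : closedFieldType) (T : choiceType) n
    (M : T -> 'M[K]_n) q (R : T -> Prop) : (1 < q)%N -> injective M ->
  (forall a, R a -> forall i j, M a i j ^+ q = M a i j) ->
  exists s : seq T, uniq s /\ forall a, a \in s <-> R a.
Proof.
move=> q1 Minj RM.
have [rs rsE] := closed_field_poly_normal ('X^q - 'X : {poly K}).
have inrs z : z ^+ q = z -> z \in rs.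
  move=> zq; have : root ('X^q - 'X) z by rewrite rootE !hornerE zq subrr.
  rewrite rsE rootZ ?root_prod_XsubC // lead_coef_eq0 subr_eq0.
  (* Since [1 < q], the coefficients of degree 1 show that ['X^q - 'X] is nonzero. *)
  apply/eqP => /(congr1 (fun p : {poly K} => p`_1)) /eqP.
  by rewrite coefXn coefX (ltn_eqF q1) eq_sym oner_eq0.
pose mat (f : {ffun 'I_n * 'I_n -> 'I_(size rs)}) : 'M[K]_n :=
  \matrix_(i, j) rs`_(f (i, j)).
pose pre f : option T := if pselect (exists a, R a /\ M a = mat f) is left H
  then Some (projT1 (cid H)) else None.
exists (undup (pmap pre (enum {: {ffun 'I_n * 'I_n -> 'I_(size rs)}}))).
split=> [|a]; first exact: undup_uniq.
rewrite mem_undup mem_pmap; split=> [/mapP[f _]|Ra].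
  rewrite /pre; case: pselect => // H; case: (cid H) => b [Rb _] [->].
  by [].
have lt_idx i j : (index (M a i j) rs < size rs)%N by rewrite index_mem inrs // RM.
pose f := [ffun ij => Ordinal (lt_idx ij.1 ij.2)].
have fE : M a = mat f.
  by apply/matrixP => i j; rewrite mxE ffunE /= nth_index // inrs // RM.
apply/mapP; exists f; first by rewrite mem_enum.
rewrite /pre; case: pselect => [H|[]]; last by exists a.
case: (cid H) => b [_ bE] /=; congr Some.
by apply: Minj; rewrite fE bE.
Qed.

End FiniteFixedPoints.

Section LangSteinberg.
Local Open Scope group_scope.
Variables (p : nat) (pr_p : prime p) (K : closedFieldType).
Variables (iota : {rmorphism 'F_p -> K}) (alg : integralRange iota).
Variables (X : lin_alg_group K) (X_conn : lag_connected X).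
Variables (sigma : X -> X) (sigmaM : {morph sigma : a b / a * b}).
Hypothesis sigma_reg : regmap sigma.

Section Coordinates.
Variables (Y : lin_alg_group K) (rho : X -> Y) (rho' : Y -> X).
Hypotheses (rhoM : lag_morphism rho) (rho'M : lag_morphism rho').
Hypotheses (rhoK : cancel rho rho') (rho'K : cancel rho' rho).

(** Coordinates taken in [Y], meant for the embedding in which a power of [sigma] raises the matrix
    entries to a power [q]. *)
Let x (a : X) := lag_coord (rho a).

Lemma polyfun_transport f : polyfun x f <-> polyfun (@lag_coord K X) f.
Proof.
split=> [[P fP]|fP].
  rewrite (_ : f = fun a => P.@[lag_coord (rho a)]); last exact/funext.
  have rhoP := regmap_morphism rhoM.
  by apply: (rhoP (fun b => P.@[lag_coord b])); exists P.
have [P PE] := regmap_morphism rho'M fP.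
by exists P => a; rewrite -[a in LHS]rhoK PE.
Qed.

Lemma transport_inj a b : x a =1 x b -> a = b.
Proof. by move=> /coord_inj/(can_inj rhoK). Qed.

Lemma transport_closed (t : 'I_(lag_dim Y * lag_dim Y).+1 -> K) :
  (forall P : {mpoly K[(lag_dim Y * lag_dim Y).+1]},
     (forall a, P.@[x a] = 0%R) -> P.@[t] = 0%R) -> exists a, x a =1 t.
Proof.
move=> tP; have [P P0|b bt] := @coord_closed _ Y t.
  by apply: tP => a; exact: P0.
by exists (rho' b) => i; rewrite /x rho'K.
Qed.

(** Both notions of closed set agree: functions on [Y] transport to functions on [X], and
    multiplying by a power of the determinant leaves their zeros unchanged. *)
Lemma transport_conn (Z1 Z2 : X -> Prop) : poly_closed x Z1 -> poly_closed x Z2 ->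
  (forall a, Z1 a \/ Z2 a) -> (forall a, Z1 a -> Z2 a -> False) ->
  (forall a, Z1 a) \/ (forall a, Z2 a).
Proof.
pose W (Z : X -> Prop) : set (GL K (lag_dim X)) := [set val a | a in Z]%classic.
have Wclosed Z : poly_closed x Z -> zariski_closed (W Z).
  move=> Zc; exists [set Q | forall a, Z a -> meval_mx Q (lag_mx a) = 0%R]%classic.
  apply/seteqP; split=> [_ [a Za <-] Q /= /(_ _ Za) //|A AP].
  have [S XS] := lag_closed X.
  have XA : subgroup_set (lag_pts X) A.
    rewrite XS => P SP; apply: AP => a _; have := eltP a.
    by rewrite {1}XS; apply.
  exists (to_elt XA) => //; apply: Zc => f /polyfun_transport /polyfun_coordP[Q [r fQ]] fZ.
  rewrite fQ (_ : meval_mx _ _ = 0%R) ?GRing.mul0r //; apply: AP => a /fZ.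
  rewrite fQ => /eqP; rewrite GRing.mulf_eq0 GRing.invr_eq0 GRing.expf_eq0.
  by rewrite (negPf (lag_det_neq0 a)) andbF orbF => /eqP.
have WE Z : (lag_pts X `<=` W Z)%classic -> forall a, Z a.
  by move=> XW a; have [b Zb /val_inj <-] := XW _ (eltP a).
move=> /Wclosed c1 /Wclosed c2 Zcover Zdisj.
have [||/WE|/WE] := X_conn c1 c2; [| |by left|by right].
  move=> A XA; have [Za|Za] := Zcover (to_elt XA); [left|right];
  by exists (to_elt XA).
apply/seteqP; split=> // A [[_ [a Za <-]] [b Zb /val_inj ba]].
by rewrite ba in Zb; exact: (Zdisj a).
Qed.

Lemma regmap_twist c : regmap (twist sigma c).
Proof.
apply: (regmapM (g := fun a => a^-1 * c)) => //.
by apply: regmapM; [exact: regmapV | exact: regmap_cst].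
Qed.

Lemma regmap_twnorm n : regmap (twnorm sigma n).
Proof.
elim: n => [|n IH]; first exact: regmap_cst.
apply: (regmapM (g := id) (h := sigma \o twnorm sigma n)) => //.
exact: regmap_comp IH sigma_reg.
Qed.

(** By [iter_twist], the matrix of [q]-th powers of the entries of [rho a] is a constant matrix
    times that of [a] times a function of [twist sigma c a]. Determinants give the remaining
    coordinate. *)
Lemma lincomb_expq e q c i :
  (forall a, lag_mx (rho (iter e sigma a)) =
     map_mx (fun z => z ^+ q)%R (lag_mx (rho a))) ->
  (forall A : 'M[K]_(lag_dim Y),
     \det (map_mx (fun z => z ^+ q) A) = \det A ^+ q)%R ->
  lincomb x (twist sigma c) (fun a => x a i ^+ q)%R.
Proof.
move=> fr detq; pose C := lag_mx (rho (twnorm sigma e c)^-1).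
pose B y := lag_mx (rho (twnorm sigma e y)).
have Breg f : polyfun (@lag_coord K Y) f -> polyfun x (fun y => f (rho (twnorm sigma e y))).
  by move=> /(regmap_morphism rhoM)/(@regmap_twnorm e) /polyfun_transport.
have eqF a : map_mx (fun z => z ^+ q)%R (lag_mx (rho a)) =
    (C *m lag_mx (rho a) *m B (twist sigma c a))%R.
  by rewrite -fr (iter_twist sigmaM e c) !rhoM.1 !lag_mxM.
move: i; apply: coord_ind => [|i j].
  rewrite (_ : (fun=> _) = fun a => (\det C)^-1 *
      (\det (B (twist sigma c a)))^-1 * x a ord0)%R.
    apply: (lincombM (f := fun y => (\det C)^-1 * (\det (B y))^-1)%R).
      apply: polyfunM; first exact: polyfun_cst.
      exact: Breg (polyfun_lag_det Y).
    exact: lincomb_coord.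
  apply/funext => a; rewrite /x coord_det GRing.exprVn -detq eqF !det_mulmx.
  by rewrite !GRing.invfM GRing.mulrAC.
rewrite (_ : (fun=> _) = fun a => \sum_k \sum_l
    (C i k * B (twist sigma c a) l j) * x a (mx_idx k l))%R.
  apply: lincomb_sum => k; apply: lincomb_sum => l.
  apply: (lincombM (f := fun y => C i k * B y l j)%R).
    apply: polyfunM; first exact: polyfun_cst.
    exact: Breg (polyfun_lag_mx l j).
  exact: lincomb_coord.
apply/funext => a; rewrite /x coord_mx.
have /matrixP/(_ i j) := eqF a; rewrite mxE => ->; rewrite mxE exchange_big.
apply: eq_bigr => l _; rewrite mxE GRing.mulr_suml; apply: eq_bigr => k _.
by rewrite coord_mx GRing.mulrAC.
Qed.

End Coordinates.

Lemma Frob_periodic_seq (zs : seq K) :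
  exists2 d, 0 < d & forall z, z \in zs -> (z ^+ (p ^ d) = z)%R.
Proof.
have per (z : K) d k : (z ^+ (p ^ d) = z -> z ^+ (p ^ (d * k)) = z)%R.
  move=> zd; elim: k => [|k IH]; first by rewrite muln0 GRing.expr1.
  by rewrite mulnS expnD GRing.exprM zd.
elim: zs => [|z zs [d d0 dP]]; first by exists 1%N.
have [d' d'0 zd'] := Frob_periodic pr_p alg z.
exists (d * d')%N => [|w]; first by rewrite muln_gt0 d0.
rewrite inE => /orP[/eqP ->|/dP wd]; last exact: per.
by rewrite mulnC; exact: per.
Qed.

Lemma det_map_Frob n (A : 'M[K]_n) d :
  (\det (map_mx (fun z => z ^+ (p ^ d)) A) = \det A ^+ (p ^ d))%R.
Proof.
elim: d A => [|d IH] A.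
  by rewrite GRing.expr1; congr (\det _)%R; apply/matrixP => i j; rewrite mxE GRing.expr1.
have Kp := Fpbar_pchar iota pr_p.
rewrite [in RHS]expnSr GRing.exprM -IH -(GRing.pFrobenius_autE Kp) -det_map_mx.
congr (\det _)%R; apply/matrixP => i j; rewrite !mxE expnSr.
by rewrite GRing.exprM -GRing.pFrobenius_autE.
Qed.

Lemma lang_regular e a0 (c : X) : 0 < a0 -> frobenius (p ^ a0) (iter e sigma) ->
  exists a : X, c = a^-1 * sigma a.
Proof.
move=> a0_gt0 [Y [rho [[rhoM [rho' rho'M [rhoK rho'K]]] fr]]].
have p_gt1 := prime_gt1 pr_p.
have q_gt1 d : 0 < d -> 1 < p ^ d by move=> d0; rewrite -(exp1n d) ltn_exp2r.
pose x (a : X) := lag_coord (rho a).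
have /choice[L LP] c' := fin_all_exists (fun i =>
  lincomb_expq rhoM rho'M rhoK c' i fr (fun A => det_map_Frob A a0)).
apply: (@lang_of_connected X sigma sigmaM K _ x (p ^ a0) L) => //.
- exact: transport_inj rhoK.
- exact: transport_closed rho'K.
- move=> c' i; apply/(polyfun_transport rhoM rho'M rhoK).
  apply: (@regmap_twist c' (x^~ i)).
  have rhoP := regmap_morphism rhoM.
  by apply: (rhoP (fun b => lag_coord b i)); exact: polyfun_coord.
- exact: q_gt1.
- by move=> c' i j; have [] := LP c' i.
- by move=> c' a i; have [_ ->] := LP c' i.
- move=> cs.
  (* All matrix entries of the elements of [cs] have a common Frobenius period [d], so these
     elements lie in the finite group of fixed points of [iter (e * d) sigma]. *)
  pose zs := flatten [seq [seq lag_mx (rho c') ij.1 ij.2 |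
      ij <- enum {: 'I_(lag_dim Y) * 'I_(lag_dim Y)}] | c' <- cs].
  have [d d0 zsd] := Frob_periodic_seq zs.
  pose R (a : X) := iter (e * d) sigma a = a.
  have itF a : lag_mx (rho (iter (e * d) sigma a)) =
      map_mx (fun z => z ^+ (p ^ (a0 * d)))%R (lag_mx (rho a)).
    elim: (d) => [|k IHk].
      by rewrite !muln0; apply/matrixP => i j; rewrite mxE GRing.expr1.
    rewrite mulnS iterD fr IHk; apply/matrixP => i j; rewrite !mxE.
    by rewrite -GRing.exprM -expnD -mulnSr.
  have Rcs c' : c' \in cs -> R c'.
    move=> c'in; apply: (can_inj rhoK); apply: lag_mx_inj; rewrite itF.
    apply/matrixP => i j; rewrite mxE.
    have zd : lag_mx (rho c') i j \in zs.
      apply/flattenP; eexists; first by apply/mapP; exists c'.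
      by apply/mapP; exists (i, j); rewrite ?mem_enum.
    elim: (a0) => [|k IHk]; first by rewrite GRing.expr1.
    by rewrite mulSn expnD GRing.exprM zsd.
  have Minj : injective (fun a => lag_mx (rho a)).
    by move=> a b /lag_mx_inj/(can_inj rhoK).
  have [||s [us sR]] := @finite_expn_fixed K X _ _ (p ^ (a0 * d)) R _ Minj.
  + by apply: q_gt1; rewrite muln_gt0 a0_gt0.
  + by move=> a Ra i j; have := itF a; rewrite Ra => /matrixP/(_ i j); rewrite mxE.
  have itM := iter_morph sigmaM (e * d).
  exists s; split=> //.
    have : 1 \in s by apply/sR; apply: (mulgI (iter (e * d) sigma 1)); rewrite -itM !mulg1.
    by case: (s).
  (* The endomorphism [sigma] commutes with its own iterates, so the fixed points are stable under
     it and hence under twisting. *)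
  move=> c' a /Rcs Rc /sR Ra; apply/sR.
  rewrite /R !itM (morph_invg _ itM) Rc Ra -iterSr iterS Ra.
  by [].
- exact: (transport_conn rhoM rho'M rhoK).
Qed.

End LangSteinberg.

Section LangIter.
Local Open Scope group_scope.
Variables (p : nat) (pr_p : prime p) (K : closedFieldType).
Variables (iota : {rmorphism 'F_p -> K}) (alg : integralRange iota).

(** The [j]-th iterate is again a Steinberg endomorphism: its [e]-th power is the [j]-th power of a
    [p ^ a0]-Frobenius, hence a [p ^ (a0 * j)]-Frobenius in the same embedding. *)
Lemma lang_steinberg (X : lin_alg_group K) (sigma : X -> X) j (c : X) :
  lag_connected X -> steinberg p sigma -> 0 < j ->
  exists a : X, c = a^-1 * iter j sigma a.
Proof.
move=> X_conn [sM [e [a0 [_ a0_gt0 fr]]]] j0.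
have jreg : regmap (iter j sigma).
  elim: (j) => [|i IH]; first by [].
  exact: regmap_comp IH (regmap_morphism sM).
apply: (lang_regular pr_p alg X_conn (iter_morph sM.1 j) jreg (e := e) (a0 := a0 * j)).
  by rewrite muln_gt0 a0_gt0.
have [Y [rho [rhoP fr']]] := fr; exists Y, rho; split=> // a.
have -> : iter e (iter j sigma) a = iter j (iter e sigma) a.
  have itX i k b : iter i (iter k sigma) b = iter (i * k) sigma b.
    by elim: i => //= i ->; rewrite mulSn iterD.
  by rewrite !itX mulnC.
elim: (j) a => [|i IH] a.
  by rewrite muln0; apply/matrixP => ? ?; rewrite mxE GRing.expr1.
rewrite iterS fr' IH; apply/matrixP => ? ?; rewrite !mxE.
by rewrite -GRing.exprM -expnD mulnS addnC.
Qed.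

End LangIter.

(** * The holomorph *)


Section Holomorph.
Local Open Scope group_scope.
Variable G : groupType.
Implicit Types (x y u h : G) (a b : aut G) (p q : hol G).

Lemma inGM : {morph @inG G : x y / x * y}.
Proof.
move=> x y; congr Hol; by rewrite mul1g.
Qed.

Lemma inG1 : inG 1 = 1 :> hol G. Proof. by []. Qed.

Lemma inGV x : inG x^-1 = (inG x)^-1.
Proof. by apply: (mulgI (inG x)); rewrite -inGM !mulgV. Qed.

Lemma conj_inG x h : inG x ^ inG h = inG (x ^ h).
Proof. by rewrite !conjgE -inGV -!inGM. Qed.

Lemma inGX x n : inG (x ^+ n) = inG x ^+ n.
Proof. by elim: n => // n IH; rewrite !expgS inGM IH. Qed.

Lemma inAM : {morph @inA G : a b / a * b}.
Proof.
move=> a b; congr Hol.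
by change (1 = 1 * a^-1 1); rewrite aut1 mulg1.
Qed.

Lemma inAX a n : inA (a ^+ n) = inA a ^+ n.
Proof. by elim: n => // n IH; rewrite !expgS inAM IH. Qed.

Lemma hol_pairE x a : inG x * inA a = Hol x a.
Proof.
congr Hol; last by rewrite mul1g.
by change (x * (1 : aut G)^-1 1 = x); rewrite aut1 mulg1.
Qed.

Lemma hol_rM p q : hol_r (p * q) = hol_r p * hol_r q. Proof. by []. Qed.

Lemma hol_rV p : hol_r p^-1 = (hol_r p)^-1. Proof. by []. Qed.

Lemma hol_rX p n : hol_r (p ^+ n) = hol_r p ^+ n.
Proof. by elim: n => // n IH; rewrite !expgS hol_rM IH. Qed.

Lemma hol_r_conj p h : hol_r (p ^ inG h) = hol_r p.
Proof. by rewrite conjgE !hol_rM hol_rV mulg1 invg1 mul1g. Qed.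

Lemma hol_split p a : hol_r p = a -> p = inG (hol_l p) * inA a.
Proof. by move=> <-; rewrite hol_pairE; case: p. Qed.

Lemma hol_conjE u h a :
  (inG u * inA a) ^ inG h = inG (h^-1 * u * a^-1 h) * inA a.
Proof.
rewrite (@hol_split ((inG u * inA a) ^ inG h) a); last by rewrite hol_r_conj hol_pairE.
congr (inG _ * _); rewrite conjgE -inGV !hol_pairE.
change (h^-1 * (1 : aut G)^-1 (u * a^-1 h) = h^-1 * u * a^-1 h).
by rewrite invg1 aut1E mulgA.
Qed.

(** Turns fixed points into commutation in the holomorph, the form in which all later computations
    are made. *)
Lemma fix_commuteP a x : a x = x <-> commute (inG x) (inA a).
Proof.
split=> [ax|/commute_sym c]; first by rewrite /commute conjgC hol_conj ax.
have : inG x ^ inA a = inG x by rewrite conjgE -c mulKg.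
by rewrite hol_conj => -[].
Qed.

End Holomorph.

(** * Shintani descent *)


Section Descent.
Local Open Scope group_scope.
Variables (G : groupType) (s : aut G).
Hypothesis lang : forall j c, 0 < j -> exists a, c = a^-1 * (s ^+ j) a.

Local Notation S := (inA s).
Local Notation fixes n x := ((s ^+ n) x = x).

Lemma fixes_commuteP n x : fixes n x <-> commute (inG x) (S ^+ n).
Proof. by rewrite -inAX; exact: fix_commuteP. Qed.

Lemma commute_conj (H : groupType) (x y z : H) :
  commute x y -> commute (x ^ z) (y ^ z).
Proof. by rewrite /commute -!conjMg => ->. Qed.

Lemma commute_dvd n k y : n %| k -> commute y (S ^+ n) -> commute y (S ^+ k).
Proof. by case/dvdnP => d ->; rewrite mulnC expgnA; exact: commuteX. Qed.

Lemma fixes_dvd n k x : n %| k -> fixes n x -> fixes k x.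
Proof. by move=> nk /fixes_commuteP c; apply/fixes_commuteP; exact: commute_dvd c. Qed.

Lemma fixes_conj n x : fixes n x -> (S ^+ n) ^ inG x = S ^+ n.
Proof. by move=> /fixes_commuteP c; rewrite conjgE -c mulKg. Qed.

Lemma fixesV n x : fixes n x -> fixes n x^-1.
Proof. by rewrite autV => ->. Qed.

Lemma conj_pow n x : exists u, (S ^+ n) ^ inG x = inG u * S ^+ n.
Proof.
exists (x^-1 * 1 * (s ^+ n)^-1 x); rewrite -inAX -hol_conjE; congr (_ ^ _).
by rewrite inG1 mul1g.
Qed.

Lemma lang_hol j c : 0 < j -> exists a, (S ^+ j) ^ inG a = inG c * S ^+ j.
Proof.
(* Conjugating [S ^+ j] by [(s ^+ j) b] gives the left factor [((s ^+ j) b)^-1 * b], the inverse of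
   [b^-1 * (s ^+ j) b]; hence the choice of [c^-1]. *)
move=> j0; have [b cb] := lang c^-1 j0; exists ((s ^+ j) b).
have := hol_conjE 1 ((s ^+ j) b) (s ^+ j); rewrite inG1 mul1g inAX => ->.
have -> : (s ^+ j)^-1 ((s ^+ j) b) = b by rewrite autVE autK.
by congr (inG _ * _); rewrite mulg1 -[c]invgK cb invgM invgK.
Qed.

(* [x s^l] lies in a [G_(s^m)]-conjugate of [<G_(s^n), s>]; the factor in <s>
   is necessarily [s^l] because [h] lies in [G]. *)
Definition in_conj l m n x := exists u h,
  [/\ fixes n u, fixes m h & inG x * S ^+ l = (inG u * S ^+ l) ^ inG h].

Definition shintani_rel l m x y := exists a,
  (inG x * S ^+ l) ^ inG a = S ^+ l /\ (S ^+ m) ^ inG a = inG y * S ^+ m.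

(** Conjugation by [b^-1] turns [S ^+ l] into an element [u S^l] commuting with [S ^+ n], so [u] is
    fixed by [s ^+ n]. The conjugator [b * a^-1] centralizes [S ^+ m]. *)
Lemma in_conj_intro l m n x a b :
  (inG x * S ^+ l) ^ inG a = S ^+ l -> (S ^+ m) ^ inG b = (S ^+ m) ^ inG a ->
  commute (S ^+ l) ((S ^+ n) ^ inG b) -> in_conj l m n x.
Proof.
move=> xa ba c; have [u uE] := conj_pow l b^-1.
exists u, (b * a^-1); split.
- apply/fixes_commuteP; have : commute (inG u * S ^+ l) (S ^+ n).
    rewrite -uE -[S ^+ n](conjgK (inG b)) -inGV; exact: commute_conj.
  have cl : commute (S ^+ n) (S ^+ l) by apply: commuteX2.
  move=> /commute_sym cu; apply: commute_sym.
  by rewrite -[inG u](mulgK (S ^+ l)); apply: commuteM => //; exact: commuteV.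
- have H : (S ^+ m) ^ inG (b * a^-1) = S ^+ m.
    by rewrite inGM conjgM ba inGV conjgK.
  by apply/fixes_commuteP; rewrite /commute -{1}H conjgE mulVKg.
by apply: (@conjg_inj _ (inG a)); rewrite xa -uE -!conjgM -!inGM mulgVK mulVg inG1 conjg1.
Qed.

(** Lang-Steinberg gives [b] moving [u S^l] to [S ^+ l]. Since [u S^l] commutes with [S ^+ n], the
    conjugate of [S ^+ n] by [b] commutes with [S ^+ l]; [h^-1 * b] witnesses the Shintani
    relation. *)
Lemma in_conj_elim l m n x : 0 < l -> l %| m -> in_conj l m n x ->
  exists b w y, [/\ (S ^+ n) ^ inG b = inG w * S ^+ n,
    commute (inG w * S ^+ n) (S ^+ l), shintani_rel l m x y &
    (S ^+ m) ^ inG b = inG y * S ^+ m].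
Proof.
move=> l0 lm [u [h [fu fh xE]]]; have [b' b'E] := lang_hol u l0.
set b := b'^-1; have bE : (inG u * S ^+ l) ^ inG b = S ^+ l.
  by rewrite -b'E inGV conjgK.
have [w wE] := conj_pow n b; have [y yE] := conj_pow m b.
exists b, w, y; split=> //.
  rewrite -wE -bE; apply: commute_conj; apply: commuteM.
    by apply: commute_sym; apply/fixes_commuteP.
  exact: commuteX2.
exists (h^-1 * b); split; first by rewrite xE -conjgM -inGM mulVKg.
by rewrite inGM conjgM fixes_conj //; exact: fixesV.
Qed.

Lemma descent_dvd l m n k x : 0 < l -> 0 < n -> l %| n -> m = (n * k)%N ->
  in_conj l m n x <-> exists2 z, fixes l z & shintani_rel l m x (z ^+ k).
Proof.
move=> l0 n0 ln mE.
have powE z : commute (inG z) (S ^+ l) ->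
    (inG z * S ^+ n) ^+ k = inG (z ^+ k) * S ^+ m.
  by move=> /(commute_dvd ln) c; rewrite expgMn // inGX mE expgnA.
split=> [|[z fz [a [xa Sa]]]].
  case/in_conj_elim => // [|b [w [y [wE c xy yE]]]].
    by rewrite mE dvdn_mulr.
  (* As [l] divides [n], the factor [S ^+ n] commutes with [S ^+ l] and can be cancelled. *)
  have cw : commute (inG w) (S ^+ l).
    rewrite -[inG w](mulgK (S ^+ n)); apply: commute_sym; apply: commuteM.
      exact: commute_sym.
    by apply: commuteV; exact: commuteX2.
  exists w; first exact/fixes_commuteP.
  suff <- : y = w ^+ k by [].
  have : inG y * S ^+ m = inG (w ^+ k) * S ^+ m.
    by rewrite -powE // -yE mE expgnA conjXg wE.
  by move/mulIg => [].
(* The [k]-th power of [z S^n] is [z^k S^m], so [b] and [a] conjugate [S ^+ m] to the same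
   element. *)
have [b bE] := lang_hol z n0.
apply: (in_conj_intro xa (b := b)).
  by rewrite [in LHS]mE expgnA conjXg bE powE ?Sa //; exact/fixes_commuteP.
rewrite bE; apply: commuteM; first by apply: commute_sym; exact/fixes_commuteP.
exact: commuteX2.
Qed.

Lemma shintani_rel_conj l m x y b : l %| m -> fixes l b -> shintani_rel l m x y ->
  shintani_rel l m x (y ^ b).
Proof.
move=> lm fb [a [xa Sa]]; exists (a * b); rewrite inGM !conjgM xa Sa.
split; first exact: fixes_conj.
have /fixes_conj c := fixes_dvd lm fb.
by rewrite conjMg c; congr (_ * _); rewrite conjgE -inGV -!inGM.
Qed.

(** The last hypothesis is the separation assumption: a conjugate of an image of [x] that is fixed
    by [s ^+ l] is conjugate to an image of [x] already under the fixed points of [s ^+ l]. *)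
Lemma descent_coprime l m n k d l' x : 0 < l -> 0 < n -> 0 < l' ->
  l = (l' * k)%N -> n = (l' * d)%N -> m = (l' * k * d)%N -> coprime k d ->
  (forall y e, shintani_rel l m x y -> fixes l (y ^ e) ->
    exists y1 c, [/\ shintani_rel l m x y1, fixes l c & y ^ e = y1 ^ c]) ->
  in_conj l m n x <->
  exists y b, [/\ shintani_rel l m x y, fixes l b & exists2 v, fixes l' v & y = v ^ b].
Proof.
move=> l0 n0 l'0 lE nE mE kd sep.
have lm : l %| m by rewrite mE lE dvdn_mulr.
have l'l : l' %| l by rewrite lE dvdn_mulr.
have nkE : m = (n * k)%N by rewrite mE nE mulnAC.
have ldE : m = (l * d)%N by rewrite mE lE.
have l'n : l' %| n by rewrite nE dvdn_mulr.
split.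
  case/in_conj_elim => // b [w [y [wE cW xy yE]]].
  set W := inG w * S ^+ n in wE cW.
  have yW : inG y = W ^+ k * ((S ^+ l) ^+ d)^-1.
    by rewrite -wE -conjXg -!expgnA -nkE -ldE yE mulgK.
  have cWl : commute W (S ^+ l) by exact: cW.
  have cyW : commute (inG y) W.
    rewrite yW; apply: commute_sym; apply: commuteM; first exact: commuteX.
    by apply: commuteV; exact: commuteX.
  have cyl : commute (inG y) (S ^+ l).
    rewrite yW; apply: commute_sym; apply: commuteM.
      by apply: commuteX; exact: commute_sym.
    by apply: commuteV; exact: commuteX.
  (* Bezout for [n] and [l], whose greatest common divisor is [l'] because [k] and [d] are coprime;
     [E] then has automorphism part [s ^+ l'] and commutes with [y]. *)
  have [r [t rt]] : exists r t, (r * n = t * l + l')%N.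
    have d0 : 0 < d by move: n0; rewrite nE muln_gt0 => /andP[].
    have [r t rt _] := egcdnP k d0; exists r, t; rewrite nE lE.
    by rewrite mulnCA rt gcdnC (eqP kd) mulnDr muln1 mulnCA.
  set E := W ^+ r * ((S ^+ l) ^+ t)^-1.
  have cyE : commute (inG y) E.
    by apply: commuteM; [exact: commuteX | apply: commuteV; exact: commuteX].
  have /hol_split : hol_r E = s ^+ l'.
    rewrite hol_rM hol_rV !hol_rX /W hol_rM mul1g !hol_rX -!expgnA.
    by rewrite (mulnC n) (mulnC l) rt addnC expgnDr mulgK.
  set c := hol_l E; rewrite inAX => Ec.
  (* Moving [E] to [S ^+ l'] carries [y] to an element fixed by [s ^+ l']; separation makes this
     conjugation take place inside the fixed points of [s ^+ l]. *)
  have [e eE] := lang_hol c l'0.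
  have fy : fixes l' (y ^ e^-1).
    apply/fixes_commuteP.
    have -> : inG (y ^ e^-1) = inG y ^ inG e^-1.
      by rewrite !conjgE !inGM !inGV.
    have -> : S ^+ l' = E ^ inG e^-1 by rewrite Ec -eE inGV conjgK.
    exact: commute_conj.
  have [y1 [c1 [xy1 fc1 yy1]]] := sep _ _ xy (fixes_dvd l'l fy).
  exists y1, c1^-1; split=> //; first exact: fixesV.
  by exists (y ^ e^-1); rewrite // yy1 conjgK.
case=> y0 [b0 [xy0 fb0 [v fv y0E]]].
have {xy0} xv : shintani_rel l m x v.
  by have := shintani_rel_conj lm (fixesV fb0) xy0; rewrite y0E conjgK.
have cv := iffLR (fixes_commuteP _ _) fv.
have cvl := commute_dvd l'l cv; have cvn := commute_dvd l'n cv.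
have k0 : 0 < k by move: l0; rewrite lE muln_gt0 => /andP[].
(* The exponents are chosen so that the [k]-th power of [v^j S^n] equals [v] times the [d]-th power
   of [v^i S^l]. *)
have [j [i ji]] : exists j i, (j * k = i * d + 1)%N.
  by have [j i ji _] := egcdnP d k0; exists j, i; rewrite ji (eqP kd).
(* Conjugation by [f^-1] straightens [v^i S^l] to [S ^+ l] and carries [B], which commutes with it,
   to an element [w S^n] commuting with [S ^+ l]. *)
have [f fE] := lang_hol (v ^+ i) l0.
pose B := inG (v ^+ j) * S ^+ n.
have [w wE] : exists w, B ^ inG f^-1 = inG w * S ^+ n.
  exists (hol_l (B ^ inG f^-1)); rewrite -inAX; apply: hol_split.
  by rewrite hol_r_conj /B -inAX hol_pairE.
have AE : (inG (v ^+ i) * S ^+ l) ^ inG f^-1 = S ^+ l.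
  by rewrite -fE inGV conjgK.
have cwl : commute (S ^+ l) (inG w * S ^+ n).
  rewrite -wE -AE; apply: commute_conj; rewrite /B !inGX.
  have c1 : commute (inG v ^+ j) (inG v ^+ i) by exact: commuteX2.
  have c2 : commute (S ^+ n) (inG v ^+ i) by apply: commuteX; exact: commute_sym.
  have c3 : commute (inG v ^+ j) (S ^+ l).
    by apply: commute_sym; apply: commuteX; exact: commute_sym.
  have c4 : commute (S ^+ n) (S ^+ l) by exact: commuteX2.
  apply: commuteM; apply: commute_sym; apply: commuteM => //.
have vE : inG v * (inG (v ^+ i) * S ^+ l) ^+ d = B ^+ k.
  rewrite /B !inGX !expgMn -?expgnA -?nkE -?ldE ?ji ?mulgA; last 2 first.
  - by apply: commute_sym; apply: commuteX; exact: commute_sym.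
  - by apply: commute_sym; apply: commuteX; exact: commute_sym.
  by rewrite addn1 expgS.
set y1 := v ^ f^-1.
have y1E : inG y1 * (S ^+ l) ^+ d = (inG w * S ^+ n) ^+ k.
  rewrite -wE -conjXg -vE conjMg conjXg AE.
  by congr (_ * _); rewrite /y1 !conjgE !inGM !inGV.
have fy1 : fixes l y1.
  apply/fixes_commuteP; rewrite -[inG y1](mulgK ((S ^+ l) ^+ d)) y1E.
  apply: commute_sym; apply: commuteM; first exact: commuteX.
  by apply: commuteV; exact: commuteX.
(* Here [y1] is only conjugate to [v] in the whole group; separation makes it an image of [x]
   again. *)
have [y2 [c [xy2 fc y1y2]]] := sep _ _ xv fy1.
have [a2 [xa2 Sa2]] := shintani_rel_conj lm fc xy2; rewrite -y1y2 in Sa2.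
have [b bE] := lang_hol w n0.
apply: (in_conj_intro xa2 (b := b)); last by rewrite bE.
by rewrite Sa2 [in LHS]nkE expgnA conjXg bE -y1E -expgnA -ldE.
Qed.

End Descent.


(** * Passage from the groups of fixed points to relations in the holomorph of the whole group *)

Section Translation.
Local Open Scope group_scope.
Local Open Scope classical_set_scope.
Variables (G : groupType) (s : aut G) (l m : nat).
Local Notation S := (inA s).
Local Notation fixes n x := ((s ^+ n) x = x).
Local Notation X_ n := (fixg (s ^+ n)).
Local Notation st := (restr (commute_sym (commuteX m (commute_refl s)))).

Lemma val_restrX n (z : elt (X_ m)) : val ((st ^+ n) z) = (s ^+ n) (val z).
Proof. by rewrite !autXE; elim: n => //= n <-. Qed.

Lemma val_restrXV n (z : elt (X_ m)) : val ((st ^+ n)^-1 z) = (s ^+ n)^-1 (val z).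
Proof.
apply: (can_inj (autK (s ^+ n))); rewrite -val_restrX.
by rewrite !autVE !autKV.
Qed.

Lemma hol_eltP n (z z' h : elt (X_ m)) :
  inG z' * inA (st ^+ n) = (inG z * inA (st ^+ n)) ^ inG h <->
  inG (val z') * S ^+ n = (inG (val z) * S ^+ n) ^ inG (val h).
Proof.
rewrite -inAX !hol_conjE -val_restrXV -gmulfV -!valM.
split=> [/mulIg[->] //|/mulIg[e]].
by congr (inG _ * _); exact: val_inj.
Qed.

Lemma commute_stP n (z : elt (X_ m)) :
  commute (inG z) (inA st ^+ n) <-> fixes n (val z).
Proof.
rewrite -inAX -fix_commuteP -val_restrX; split=> [->//|e]; exact: val_inj.
Qed.

Fact cent_closed (H : groupType) (t : H) :
  group_closed [pred x | x \in [set x : H | commute x t]].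
Proof.
split=> [|x y]; first by apply: mem_set; exact/commute_sym/commute1.
move=> /set_mem xt /set_mem yt; apply: mem_set => /=.
by apply: commute_sym; apply: commuteM; [|apply: commuteV]; exact: commute_sym.
Qed.

(** The generators centralize [inA st ^+ n], hence so does the group they generate. An element of it
    with automorphism part [st ^+ l] therefore has its left factor fixed by [s ^+ n]. *)
Lemma in_conjP n (x : elt (X_ m)) : n %| m ->
  (exists h : elt (X_ m), conj_set
    (generated ([set inG u | u in [set u : elt (X_ m) | subgroup_set (X_ n) (val u)]]
               `|` [set inA st])) (inG h) (inG x * inA st ^+ l)) <->
  in_conj s l m n (val x).
Proof.
move=> nm; split=> [[h [q qM qE]]|[u [h [fu fh xE]]]].
  have /hol_split qs : hol_r q = st ^+ l.
    by rewrite -(hol_r_conj q h) qE -inAX hol_pairE.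
  have cq : commute q (inA st ^+ n).
    have := qM (Subgroup (cent_closed (inA st ^+ n))); apply=> _ [[u fu <-]|->].
      exact/commute_stP.
    exact: commuteX.
  exists (val (hol_l q)), (val h); split.
  - apply/commute_stP; rewrite -[inG _](mulgK (inA (st ^+ l))) -qs.
    apply: commute_sym; apply: commuteM; first exact: commute_sym.
    by apply: commuteV; rewrite inAX; exact: commuteX2.
  - exact: (eltP h).
  - by apply/hol_eltP; rewrite -qs qE inAX.
have fum : fixes m u by exact: fixes_dvd fu.
exists (to_elt (fh : subgroup_set (X_ m) h)).
exists (inG (to_elt (fum : subgroup_set (X_ m) u)) * inA (st ^+ l)).
  move=> H MH; have H1 : subgroup_set H 1.
    by apply: set_mem; exact: (subgroup_closed H).1.
  have HM a b : subgroup_set H a -> subgroup_set H b -> subgroup_set H (a * b).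
    move=> Ha Hb; apply: set_mem.
    exact: (group_closedM (subgroup_closed H) (mem_set Ha) (mem_set Hb)).
  rewrite inAX; apply: (HM).
    by apply: MH; left; exists (to_elt (fum : subgroup_set (X_ m) u)).
  have Hst : subgroup_set H (inA st) by apply: MH; right.
  by elim: (l) => // i IH; rewrite expgS; exact: HM.
by rewrite -[inA st ^+ l]inAX; apply/esym/hol_eltP.
Qed.

(** Other representatives [x'] and [y'] of the two classes differ by conjugators fixed by [s ^+ m]
    and [s ^+ l], which are absorbed into the simultaneous conjugator. *)
Lemma shintani_relP (x : elt (X_ m)) (y : elt (X_ l)) : l %| m ->
  shintani (commuteX2 m l (commute_refl s))
    (conj_class (range (@inG _)) (inG x * inA st ^+ l)) (inG y) <->
  shintani_rel s l m (val x) (val y).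
Proof.
move=> lm; set c12 := commuteX2 m l (commute_refl s).
have r1 : restr c12 = st ^+ l.
  by apply: autP => z; apply: val_inj; rewrite val_restrX.
(* Since [l] divides [m], the restriction of [s ^+ m] to the fixed points of [s ^+ l] is trivial. *)
have r2 : restr (commute_sym c12) = 1.
  by apply: autP => z; apply: val_inj; apply: fixes_dvd lm _; exact: (eltP z).
split=> [[x' [y' [xx' [a [xa Sa]] [_ [c _ <-] cE]]]]|[a [xa Sa]]].
  have : conj_class (range (@inG _)) (inG x * inA st ^+ l) (inG x' * inA (restr c12)).
    rewrite xx'; exists 1; last exact: conjg1.
    by exists 1.
  case=> _ [h _ <-]; rewrite r1 -inAX => /esym/hol_eltP hE.
  have -> : val y = val y' ^ val c.
    move: cE; rewrite r2 [inA 1]inG1 mulg1 conj_inG => -[<-].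
    by rewrite gmulfJ.
  apply: shintani_rel_conj lm (eltP c) _; exists (val h * a).
  split; first by rewrite inGM conjgM -hE -inAX xa.
  by rewrite inGM conjgM (fixes_conj (eltP h)) -inAX Sa.
exists x, y; split.
- by rewrite r1 inAX.
- by exists a; rewrite !inAX.
- exists 1; first by exists 1.
  by rewrite conjg1 r2 [inA 1]inG1 mulg1.
Qed.

End Translation.


Local Open Scope group_scope.
Local Open Scope classical_set_scope.

(** As [x] is fixed by [s ^+ m], the elements [x S^l] and [S ^+ m] commute; so do their conjugates
    [S ^+ l] and [y S^m]. *)
Lemma shintani_rel_fixes (G : groupType) (s : aut G) l m (x y : G) :
  (s ^+ m) x = x -> shintani_rel s l m x y -> (s ^+ l) y = y.
Proof.
move=> /fixes_commuteP cx [a [xa Sa]]; apply/fixes_commuteP.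
rewrite -[inG y](mulgK (inA s ^+ m)) -Sa.
apply: commute_sym; apply: commuteM; last by apply: commuteV; exact: commuteX2.
rewrite -{1}xa; apply: commute_conj; apply: commute_sym; apply: commuteM.
  exact: commute_sym.
exact: commuteX2.
Qed.

Theorem corollary2p12
  (p : nat) (pr_p : prime p)
  (K : closedFieldType) (iota : {rmorphism 'F_p -> K})
  (alg : integralRange iota)
  (X : lin_alg_group K) (X_conn : lag_connected X)
  (sigma : X -> X) (sigmaP : steinberg p sigma)
  (l m k : nat) (l_gt0 : 0 < l) (m_gt0 : 0 < m) (l_dvd_m : l %| m)
  (pr_k : prime k) (k_dvd_m : k %| m) :
  let s : aut X := steinberg_aut pr_p alg sigmaP in
  let X_ (n : nat) : subgroup X := fixg (s ^+ n) in
  (* sigma~, as an automorphism of X_(sigma^m) *)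
  let st : aut (elt (X_ m)) :=
    restr (commute_sym (commuteX m (commute_refl s))) in
  forall x : elt (X_ m),
  let g : hol (elt (X_ m)) := inG x * inA st ^+ l in
  (* <X_(sigma^(m/k)), sigma~> *)
  let M : set (hol (elt (X_ m))) :=
    generated ([set inG u | u in [set u : elt (X_ m) |
                                   subgroup_set (X_ (m %/ k)) (val u)]]
               `|` [set inA st]) in
  (* the X_(sigma^l)-class F(x sigma~^l), as a subset of X_(sigma^l) *)
  let Fg : set (elt (X_ l)) :=
    [set y | shintani (commuteX2 m l (commute_refl s))
               (conj_class (range (@inG _)) g) (inG y)] in
  (k %| m %/ l ->
     ((exists h : elt (X_ m), conj_set M (inG h) g) <->
      (exists z : elt (X_ l), Fg (z ^+ k)))) /\
  (let FgX : set X := [set val y | y in Fg] in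
   conj_closure setT FgX `&` subgroup_set (X_ l) =
     conj_closure (subgroup_set (X_ l)) FgX ->
   ~~ (k %| m %/ l) ->
     ((exists h : elt (X_ m), conj_set M (inG h) g) <->
      (exists (y : elt (X_ l)) (b : elt (X_ l)),
         Fg y /\ conj_set (subgroup_set (X_ (l %/ k))) (val b) (val y)))).
Proof.
move=> s X_ st x g M Fg.
have lang j c : 0 < j -> exists a, c = a^-1 * (s ^+ j) a.
  move=> j0; have [a ->] := lang_steinberg pr_p alg c X_conn sigmaP j0.
  exists a; congr (_ * _); rewrite autXE; elim: (j) => //= i ->.
  by rewrite steinberg_autE.
have [n mE] : exists n, m = (n * k)%N by apply/dvdnP.
have k0 := prime_gt0 pr_k.
have n0 : 0 < n by move: m_gt0; rewrite mE muln_gt0 => /andP[].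
have nE : m %/ k = n by rewrite mE mulnK.
have [d dE] : exists d, m = (d * l)%N by apply/dvdnP.
have dlE : m %/ l = d by rewrite dE mulnK.
have FgE y : Fg y <-> shintani_rel s l m (val x) (val y) by exact: shintani_relP.
have ME : (exists h : elt (X_ m), conj_set M (inG h) g) <-> in_conj s l m n (val x).
  rewrite /M nE; apply: in_conjP.
  by rewrite mE dvdn_mulr.
have fx : (s ^+ m) (val x) = val x := eltP x.
split=> [|FgX sepX]; rewrite dlE => kd.
  have ln : l %| n.
    rewrite -nE dE; case/dvdnP: kd => q ->.
    by rewrite mulnAC mulnK // dvdn_mull.
  rewrite ME (descent_dvd lang (val x) l_gt0 n0 ln mE).
  split=> [[z fz xz]|[z /FgE xz]].
    exists (to_elt (fz : subgroup_set (X_ l) z)); apply/FgE.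
    by rewrite gmulfXn.
  by exists (val z); [exact: (eltP z) | rewrite -gmulfXn].
(* The prime [k] divides [m = d * l] but not [d], so it divides [l]. *)
have [l' lE] : exists l', l = (l' * k)%N.
  apply/dvdnP; move: k_dvd_m.
  by rewrite dE Euclid_dvdM // (negPf kd).
have l'E : l %/ k = l' by rewrite lE mulnK.
have l'0 : 0 < l' by move: l_gt0; rewrite lE muln_gt0 => /andP[].
have nE' : n = (l' * d)%N by rewrite -nE dE lE mulnA mulnK // mulnC.
have mE' : m = (l' * k * d)%N by rewrite dE lE mulnC.
have ckd : coprime k d by rewrite prime_coprime.
(* The assumed equality of classes, applied to a conjugate of an image of [x] lying in [X_ l], is
   the separation hypothesis of the coprime case. *)
have sep y e : shintani_rel s l m (val x) y -> (s ^+ l) (y ^ e) = y ^ e ->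
    exists y1 c, [/\ shintani_rel s l m (val x) y1, (s ^+ l) c = c & y ^ e = y1 ^ c].
  move=> xy fye; have fy := shintani_rel_fixes fx xy.
  have : (conj_closure setT FgX `&` subgroup_set (X_ l)) (y ^ e).
    split=> //; exists y; last by exists e.
    by exists (to_elt (fy : subgroup_set (X_ l) y)) => //; exact/FgE.
  rewrite sepX => -[_ [y1 /FgE xy1 <-] [c fc yE]].
  by exists (val y1), c.
rewrite ME (descent_coprime lang l_gt0 n0 l'0 lE nE' mE' ckd sep) l'E.
split=> [[y [b [xy fb [v fv yE]]]]|[y [b [/FgE xy [v fv yE]]]]].
  have fy := shintani_rel_fixes fx xy.
  exists (to_elt (fy : subgroup_set (X_ l) y)), (to_elt (fb : subgroup_set (X_ l) b)).
  by split; [exact/FgE | exists v].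
by exists (val y), (val b); split=> //; [exact: (eltP b) | exists v].
Qed.
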